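(* The inequality $\|p(M)\|\le 2\max_{z\in W(M)}|p(z)|$ holds for every polynomial $p$ with complex coefficients and every matrix $M$ of the form $$M=\begin{bmatrix}a&b_1&0\\c_1&a&b_2\\0&c_2&a\end{bmatrix},\qquad a,b_1,b_2,c_1,c_2\in\mathbb C;$$ or equivalently, the same inequality holds for every polynomial $p$ and every matrix $M\in\mathbb C^{3\times 3}$ whose numerical range $W(M)$ is an ellipse centered at an eigenvalue of $M$.
   Context: For a square complex matrix $M$, $W(M)=\{x^*Mx : x^*x=1\}$ is the numerical range, and $\|\cdot\|$ is the operator 2-norm (largest singular value). ''Ellipse'' means the closed filled region $\{z\in\mathbb C: |z-f_1|+|z-f_2|\le L\}$ with foci $f_1,f_2\in\mathbb C$ and $L\ge |f_1-f_2|$, where degenerate cases (segments, points) are allowed; its center is $(f_1+f_2)/2$. *)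

(* Defs.v *)
From HB Require Import structures.
From mathcomp Require Import all_boot all_order all_algebra.
From mathcomp Require Import all_classical all_reals.
From mathcomp Require Import complex.
Set Implicit Arguments.
Unset Strict Implicit.
Unset Printing Implicit Defensive.
Import Order.TTheory GRing.Theory Num.Theory.
Local Open Scope classical_set_scope.
Local Open Scope ring_scope.
Local Open Scope complex_scope.

(* The norm `|z| of z : R[i] takes its values in R[i]; the R-valued modulus is
   [Normc.normc]. *)
Definition cmod (R : realType) (z : R[i]) : R := Normc.normc z.

Definition adjmx (R : realType) (m n : nat) (A : 'M[R[i]]_(m, n)) :
    'M[R[i]]_(n, m) := map_mx (@conjc R) A^T.

(* Euclidean norm on column vectors; the library's norm on matrices is the
   max norm. *)
Definition norm2 (R : realType) (n : nat) (x : 'cV[R[i]]_n) : R :=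
  Num.sqrt (\sum_(i < n) cmod (x i 0) ^+ 2).

(* The set is nonempty and bounded for n > 0, so that [sup] is a genuine
   supremum. *)
Definition opnorm (R : realType) (n : nat) (A : 'M[R[i]]_n) : R :=
  sup [set norm2 (A *m x) | x in [set x : 'cV[R[i]]_n | norm2 x = 1]].

Definition numerical_range (R : realType) (n : nat) (M : 'M[R[i]]_n) :
    set R[i] :=
  [set (adjmx x *m M *m x) 0 0
     | x in [set x : 'cV[R[i]]_n | adjmx x *m x = 1%:M]].

Definition is_maximum (R : realType) (A : set R) (m : R) : Prop :=
  A m /\ ubound A m.

(* ||p(M)|| <= 2 max_{z in W(M)} |p(z)|, including that the maximum is
   attained. *)
Definition crouzeix_ineq (R : realType) (n : nat) (M : 'M[R[i]]_n.+1)
    (p : {poly R[i]}) : Prop :=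
  exists2 m : R,
    is_maximum [set cmod p.[z] | z in numerical_range M] m
    & opnorm (horner_mx M p) <= 2 * m.

Definition ellipse (R : realType) (f1 f2 : R[i]) (L : R) : set R[i] :=
  [set z | cmod (z - f1) + cmod (z - f2) <= L].

Definition is_ellipse_centered (R : realType) (E : set R[i]) (c : R[i]) :
    Prop :=
  exists f1 f2 : R[i], exists L : R,
    [/\ cmod (f1 - f2) <= L, E = ellipse f1 f2 L & c = (f1 + f2) / 2].

Definition tridiag3 (R : realType) (a b1 b2 c1 c2 : R[i]) : 'M[R[i]]_3 :=
  \matrix_(i < 3, j < 3)
    (nth [::] [:: [:: a ; b1; 0 ];
                  [:: c1; a ; b2];
                  [:: 0 ; c2; a ]] i)`_j.

(* Main.v *)
(* Let W carry polynomials e_n, orthogonal for suitable averages over points of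
   W, with squared norms h_n. If |f| <= m on W, multiplication by f has norm at
   most m for the resulting l^2 norm on polynomials, hence also for the dual
   norm phi |-> (sum_n |phi(e_n)|^2 / h_n)^(1/2) on functionals. Applied to the
   functionals q |-> l(q(M) v), where l is a row vector, this bounds a sum of
   squares of linear forms at p(M) v by m^2 times the same sum at v. A sum of
   the form P(v), with P a positive form of condition number at most 4, then
   yields ||p(M)|| <= 2 m.

   A tridiagonal M with constant diagonal is, up to affine maps, transposition
   and unitary similarity, of one of two kinds. If M - a is not nilpotent, it is
   N = [[0, rc, s/r], [c/r, 0, 0], [rs, 0, 0]] with c^2 + s^2 = 1, r >= 1.
   W(N) contains the ellipse (r w + 1/(r w))/2, |w| = 1, on which the Chebyshev
   polynomials are orthogonal. Since N^3 = N, the sequence T_n(N) has period 4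
   and the dual norms can be compared explicitly with geometric series; for
   r^2 <= 2 a diagonal similarity of condition number r^2 makes N self-adjoint.
   Otherwise W(M) is a disc, the e_n are the monomials, and P is a form for
   which M is a contraction with defect a sum of two squares.

   If W(M) is an ellipse centred at an eigenvalue, taken to be 0, a unitary
   similarity makes the first row vanish. By Kippenhahn, the support function of
   the ellipse gives two roots of det(z M + (z M)^* - x) for every |z| = 1;
   comparing trace, minors and determinant forces M to be unitarily similar to a
   tridiagonal matrix with zero diagonal, or W(M) to be a disc and M to be of the
   form [[0, 0, 0], [a, t, 0], [c, d, 0]] covered by the disc argument. *)

Require Import Defs.
From HB Require Import structures.
From mathcomp Require Import all_boot all_order all_algebra.
From mathcomp Require Import all_classical all_reals.
From mathcomp Require Import topology normedtype derive.
From mathcomp Require Import cyclic separable cyclotomic complex ring lra.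
Import Order.TTheory GRing.Theory Num.Theory.
Local Open Scope ring_scope.
Local Open Scope complex_scope.

(** * Dual norms of orthogonal systems *)

Section OrthogonalSystem.
Context {R : realType}.
Local Notation C := R[i].
Local Notation "z ^c" := (conjc z) (at level 1, format "z ^c").
Local Notation Re := (@complex.Re _).
Local Notation Im := (@complex.Im _).
Implicit Types (z w : C) (p q f : {poly C}).

Definition nsq z : R := Re z ^+ 2 + Im z ^+ 2.

Lemma nsq_ge0 z : 0 <= nsq z.
Proof. by rewrite addr_ge0 // sqr_ge0. Qed.

Lemma nsqC z : (nsq z)%:C = z * z^c.
Proof. by case: z => a b; apply/eqP; rewrite eq_complex /nsq /=; apply/andP; split; apply/eqP; ring. Qed.

Lemma conjcN z : (- z)^c = - z^c.
Proof. exact: (rmorphN (@conjc R)). Qed.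

Lemma conjcD z w : (z + w)^c = z^c + w^c.
Proof. exact: (rmorphD (@conjc R)). Qed.

Lemma conjcM z w : (z * w)^c = z^c * w^c.
Proof. exact: (rmorphM (@conjc R)). Qed.

Lemma conjcX z k : (z ^+ k)^c = z^c ^+ k.
Proof. exact: (rmorphXn (@conjc R)). Qed.

Lemma nsqM z w : nsq (z * w) = nsq z * nsq w.
Proof. by case: z => a b; case: w => c d; rewrite /nsq /=; ring. Qed.

Lemma nsq_conj z : nsq z^c = nsq z.
Proof. by case: z => a b; rewrite /nsq /=; ring. Qed.

Lemma nsqN z : nsq (- z) = nsq z.
Proof. by case: z => a b; rewrite /nsq /=; ring. Qed.

Lemma nsq_real (x : R) : nsq x%:C = x ^+ 2.
Proof. by rewrite /nsq /=; ring. Qed.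

Lemma nsq0 : nsq 0 = 0.
Proof. by rewrite nsq_real expr0n. Qed.

Lemma nsq_eq0 z : nsq z = 0 -> z = 0.
Proof.
case: z => a b /eqP; rewrite /nsq /= paddr_eq0 ?sqr_ge0 //.
by rewrite !sqrf_eq0 => /andP[/eqP -> /eqP ->].
Qed.

Lemma cmod_sqr z : cmod z ^+ 2 = nsq z.
Proof. by case: z => a b; rewrite /cmod /= sqr_sqrtr // addr_ge0 ?sqr_ge0. Qed.

Lemma cmod_ge0 z : 0 <= cmod z.
Proof. by case: z => a b; rewrite sqrtr_ge0. Qed.

Lemma ler_double_of_sqr (t u v : R) : 0 <= u -> 0 <= v -> t ^+ 2 <= u * v -> 2 * t <= u + v.
Proof.
move=> u0 v0 tuv; rewrite leNgt; apply/negP => uvt.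
have : (u + v) ^+ 2 < (2 * t) ^+ 2 by rewrite ltr_pXn2r // ?nnegrE; lra.
by have := sqr_ge0 (u - v); lra.
Qed.

Lemma nsqD_le z w (X Y u v : R) : 0 <= X -> 0 <= Y -> 0 <= u -> 0 <= v ->
  nsq z <= X * Y -> nsq w <= u * v -> nsq (z + w) <= (X + u) * (Y + v).
Proof.
case: z => a b; case: w => c d; rewrite /nsq /= => X0 Y0 u0 v0 zXY wuv.
have : 2 * (a * c + b * d) <= X * v + u * Y.
  apply: ler_double_of_sqr; rewrite ?mulr_ge0 //.
  apply: (@le_trans _ _ ((a ^+ 2 + b ^+ 2) * (c ^+ 2 + d ^+ 2))).
    by have := sqr_ge0 (a * d - b * c); lra.
  have -> : X * v * (u * Y) = (X * Y) * (u * v) by ring.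
  by apply: ler_pM => //; rewrite addr_ge0 ?sqr_ge0.
by lra.
Qed.

Lemma weighted_CauchySchwarz (h : nat -> R) (a b : nat -> C) D :
  (forall n, 0 < h n) ->
  nsq (\sum_(n < D) a n * b n) <=
  (\sum_(n < D) h n * nsq (a n)) * (\sum_(n < D) nsq (b n) / h n).
Proof.
move=> h0; have hn n := ltW (h0 n).
elim: D => [|D IH]; first by rewrite !big_ord0 nsq0 mul0r.
rewrite !big_ord_recr /=; apply: nsqD_le => //.
- by apply: sumr_ge0 => n _; rewrite mulr_ge0 ?nsq_ge0.
- by apply: sumr_ge0 => n _; rewrite divr_ge0 ?nsq_ge0.
- by rewrite mulr_ge0 ?nsq_ge0.
- by rewrite divr_ge0 ?nsq_ge0.
- have hD : h D != 0 by rewrite gt_eqF.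
  by rewrite nsqM le_eqVlt; apply/orP; left; apply/eqP; field.
Qed.

Lemma linear_sum_scale (phi : {poly C} -> C) (e : nat -> {poly C}) (a : nat -> C) D :
  scalar phi -> phi (\sum_(n < D) a n *: e n) = \sum_(n < D) a n * phi (e n).
Proof.
move=> lphi.
have phi0 : phi 0 = 0 by have := lphi (-1) 0 0; rewrite scaler0 addr0 mulN1r addNr.
elim: D => [|D IH]; first by rewrite !big_ord0.
by rewrite !big_ord_recr /= -IH addrC lphi addrC.
Qed.

Lemma sum_ord_widen {V : nmodType} (F : nat -> V) D D' : (D <= D')%N ->
  (forall n, (D <= n)%N -> F n = 0) -> \sum_(n < D') F n = \sum_(n < D) F n.
Proof.
move=> DD' F0; rewrite (big_ord_widen _ F DD') [LHS](bigID (fun n : 'I_D' => (n < D)%N)) /=.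
by rewrite [X in _ + X]big1 ?addr0 // => n; rewrite -leqNgt => /F0.
Qed.

Definition spans (e : nat -> {poly C}) :=
  forall q, exists D (a : nat -> C), q = \sum_(n < D) a n *: e n.

(* The measure may depend on D: roots of unity of order k integrate monomials
   correctly only in degrees below k. *)
Definition orthogonal_on (W : set C) (e : nat -> {poly C}) (h : nat -> R) :=
  forall D, exists K (z : 'I_K.+1 -> C), (forall j, W (z j)) /\
    forall n m, (n < D)%N -> (m < D)%N ->
      \sum_j (e n).[z j] * (e m).[z j]^c = if n == m then (K.+1%:R * h n)%:C else 0.

Lemma sum_nsq_orthogonal (e : nat -> {poly C}) (h : nat -> R) D K (z : 'I_K.+1 -> C) (a : nat -> C) :
  (forall n m, (n < D)%N -> (m < D)%N ->
      \sum_j (e n).[z j] * (e m).[z j]^c = if n == m then (K.+1%:R * h n)%:C else 0) ->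
  \sum_j nsq (\sum_(n < D) a n *: e n).[z j] = K.+1%:R * \sum_(n < D) h n * nsq (a n).
Proof.
move=> orth; apply: (@complexI R); rewrite rmorph_sum /=.
transitivity (\sum_j \sum_(n < D) \sum_(m < D)
    a n * (a m)^c * ((e n).[z j] * (e m).[z j]^c)).
  apply: eq_bigr => j _; rewrite nsqC horner_sum rmorph_sum mulr_suml; apply: eq_bigr => n _.
  rewrite mulr_sumr; apply: eq_bigr => m _; rewrite !hornerZ rmorphM /=; ring.
rewrite exchange_big /= mulr_sumr rmorph_sum; apply: eq_bigr => n _.
rewrite exchange_big /= (bigD1 n) //= -mulr_sumr orth // eqxx big1 ?addr0 => [|m mn].
  by rewrite -nsqC -rmorphM /=; congr (_ %:C); ring.
by rewrite -mulr_sumr orth // eq_sym (inj_eq val_inj) (negbTE mn) mulr0.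
Qed.

(* The sums below are the squared dual norms of phi attached to (e, h), truncated;
   multiplication by f has norm at most sup |f| for the primal norm. *)
Lemma dual_norm_mul {W : set C} {e : nat -> {poly C}} {h : nat -> R} :
  (forall n, 0 < h n) -> spans e -> orthogonal_on W e h ->
  forall (f : {poly C}) (mu : R), (forall z, W z -> nsq f.[z] <= mu) ->
  forall phi : {poly C} -> C, scalar phi ->
  forall J, exists E, \sum_(n < J) nsq (phi (e n * f)) / h n <=
    mu * \sum_(n < E) nsq (phi (e n)) / h n.
Proof.
move=> h0 span orth f mu fmu phi lphi J; have hn n := ltW (h0 n).
have hC n : (h n)%:C != 0 :> C by rewrite eq_complex /= gt_eqF.
pose g n := phi (e n * f); set S := \sum_(n < J) _.
pose b n := if (n < J)%N then (g n)^c / (h n)%:C else 0.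
pose p := \sum_(n < J) b n *: e n.
have [D0 [a0 qE0]] := span (p * f).
pose a n := if (n < D0)%N then a0 n else 0.
have wide E : (maxn D0 J <= E)%N -> \sum_(n < E) a n *: e n = p * f
    /\ \sum_(n < E) b n *: e n = p.
  rewrite geq_max => /andP[DE JE]; split.
    rewrite (@sum_ord_widen _ (fun n => a n *: e n) _ _ DE) => [|n]; last first.
      by rewrite /a leqNgt => /negbTE ->; rewrite scale0r.
    by rewrite qE0; apply: eq_bigr => n _; rewrite /a ltn_ord.
  rewrite (@sum_ord_widen _ (fun n => b n *: e n) _ _ JE) // => n.
  by rewrite /b leqNgt => /negbTE ->; rewrite scale0r.
pose E := maxn D0 J; exists E; set B := \sum_(n < E) _; have [qE pE] := wide E (leqnn _).
have JE : (J <= E)%N by rewrite leq_maxr.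
have S0 : 0 <= S by apply: sumr_ge0 => n _; rewrite divr_ge0 ?nsq_ge0.
have phiS : phi (p * f) = S%:C.
  have lphif : scalar (fun q => phi (q * f)).
    by move=> c q1 q2; rewrite mulrDl -scalerAl lphi.
  rewrite (linear_sum_scale _ e b _ lphif) rmorph_sum; apply: eq_bigr => n _.
  by rewrite /b ltn_ord /g fmorph_div /= nsqC; ring.
have bS : \sum_(n < E) h n * nsq (b n) = S.
  rewrite (@sum_ord_widen _ (fun n => h n * nsq (b n)) _ _ JE) => [|n]; last first.
    by rewrite /b leqNgt => /negbTE ->; rewrite nsq0 mulr0.
  apply: eq_bigr => n _; rewrite /b ltn_ord -fmorphV nsqM nsq_conj nsq_real /g.
  by field; rewrite gt_eqF.
have [K [z [zW ez]]] := orth E.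
have aS : \sum_(n < E) h n * nsq (a n) <= mu * S.
  rewrite -(ler_pM2l (ltr0Sn R K)) -(sum_nsq_orthogonal _ _ _ _ _ a ez) qE.
  rewrite mulrCA -bS -(sum_nsq_orthogonal _ _ _ _ _ b ez) pE mulr_sumr.
  by apply: ler_sum => j _; rewrite hornerM nsqM mulrC ler_wpM2r ?nsq_ge0 ?fmu.
have : S ^+ 2 <= (mu * S) * B.
  rewrite -nsq_real -phiS -qE (linear_sum_scale _ _ _ _ lphi).
  apply: (le_trans (weighted_CauchySchwarz h a (fun n => phi (e n)) E h0)).
  by rewrite ler_wpM2r // sumr_ge0 // => n _; rewrite divr_ge0 ?nsq_ge0.
have := S0; rewrite le_eqVlt => /orP[/eqP <- _|S1 S2].
  rewrite mulr_ge0 //; last by apply: sumr_ge0 => n _; rewrite divr_ge0 ?nsq_ge0.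
  exact: le_trans (nsq_ge0 _) (fmu _ (zW ord0)).
by move: S2; rewrite expr2 mulrAC ler_pM2r.
Qed.

End OrthogonalSystem.

(** * The squared inequality and its invariance *)

Section Crouzeix.
Context {R : realType}.
Local Notation C := R[i].
Local Notation "z ^c" := (conjc z) (at level 1, format "z ^c").
Local Notation Re := (@complex.Re _).
Local Notation Im := (@complex.Im _).
Implicit Types (z w : C) (p q f : {poly C}).

Definition N2 {n} (x : 'cV[C]_n) : R := \sum_(i < n) nsq (x i 0).

Lemma N2_ge0 {n} (x : 'cV[C]_n) : 0 <= N2 x.
Proof. by apply: sumr_ge0 => i _; apply: nsq_ge0. Qed.

Lemma N2_norm {n} (x : 'cV[C]_n) : norm2 x ^+ 2 = N2 x.
Proof.
rewrite sqr_sqrtr; last by apply: sumr_ge0 => i _; rewrite sqr_ge0.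
by apply: eq_bigr => i _; apply: cmod_sqr.
Qed.

Lemma N2_adj {n} (x : 'cV[C]_n) : (adjmx x *m x) 0 0 = (N2 x)%:C.
Proof.
by rewrite mxE rmorph_sum; apply: eq_bigr => i _; rewrite !mxE /= nsqC mulrC.
Qed.

Lemma adj_unitP {n} (x : 'cV[C]_n) : adjmx x *m x = 1%:M <-> N2 x = 1.
Proof.
split=> [xx|Nx]; first by apply: (@complexI R); rewrite -N2_adj xx mxE.
by apply/matrixP => i j; rewrite !ord1 N2_adj Nx !mxE.
Qed.

Lemma adjmxM {m n k} (A : 'M[C]_(m, n)) (B : 'M[C]_(n, k)) :
  adjmx (A *m B) = adjmx B *m adjmx A.
Proof. by rewrite /adjmx trmx_mul (map_mxM (@conjc R)). Qed.

Lemma adjmxK {m n} (A : 'M[C]_(m, n)) : adjmx (adjmx A) = A.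
Proof. by apply/matrixP => i j; rewrite !mxE conjcK. Qed.

Lemma N2_unitary {n} (U : 'M[C]_n) (x : 'cV[C]_n) :
  adjmx U *m U = 1%:M -> N2 (U *m x) = N2 x.
Proof.
move=> UU; apply: (@complexI R).
by rewrite -!N2_adj adjmxM mulmxA -(mulmxA (adjmx x)) UU mulmx1.
Qed.

Lemma N2Z {n} (c : C) (x : 'cV[C]_n) : N2 (c *: x) = nsq c * N2 x.
Proof. by rewrite /N2 mulr_sumr; apply: eq_bigr => i _; rewrite mxE nsqM. Qed.

Lemma N2_eq0 {n} (x : 'cV[C]_n) : N2 x = 0 -> x = 0.
Proof.
move/eqP; rewrite psumr_eq0 => [/allP x0|i _]; last exact: nsq_ge0.
apply/matrixP => i j; rewrite ord1 mxE; apply: nsq_eq0; apply/eqP.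
by apply: (implyP (x0 i _)) => //; rewrite mem_index_enum.
Qed.

Lemma numerical_rangeP {n} (M : 'M[C]_n) z :
  numerical_range M z <-> exists2 x, N2 x = 1 & z = (adjmx x *m M *m x) 0 0.
Proof.
by split=> [[x /adj_unitP xx <-]|[x /adj_unitP xx ->]]; exists x.
Qed.

Lemma horner_mx_intertwine {m n} (X : 'M[C]_(m.+1, n.+1)) (A : 'M[C]_n.+1) (B : 'M[C]_m.+1) p :
  X *m A = B *m X -> X *m horner_mx A p = horner_mx B p *m X.
Proof.
move=> XA; elim/poly_ind: p => [|p c IH]; first by rewrite !rmorph0 mulmx0 mul0mx.
rewrite !rmorphD !rmorphM /= !horner_mx_X !horner_mx_C mulmxDr mulmxDl scalar_mxC.
by rewrite -!mulmxE mulmxA IH -!mulmxA XA.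
Qed.

Lemma horner_mx_tr {n} (A : 'M[C]_n.+1) p : horner_mx A^T p = (horner_mx A p)^T.
Proof.
elim/poly_ind: p => [|p c IH]; first by rewrite !rmorph0 trmx0.
rewrite !rmorphD !rmorphM /= !horner_mx_X !horner_mx_C raddfD /= tr_scalar_mx.
by rewrite IH -!mulmxE -trmx_mul; congr (_^T + _); apply: comm_mx_horner.
Qed.

Lemma horner_mx_affine {n} (A : 'M[C]_n.+1) a s p :
  horner_mx (a%:M + s *: A) p = horner_mx A (p \Po (s *: 'X + a%:P)).
Proof.
elim/poly_ind: p => [|p c IH]; first by rewrite comp_poly0 !rmorph0.
rewrite comp_polyD comp_polyM comp_polyX comp_polyC !rmorphD !rmorphM /= IH.
by rewrite rmorphD /= horner_mxZ !horner_mx_X !horner_mx_C [a%:M + _]addrC.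
Qed.

Definition crouzeix_sq {n} (M : 'M[C]_n.+1) := forall p (mu : R),
  (forall z, numerical_range M z -> nsq p.[z] <= mu) ->
  forall x, N2 (horner_mx M p *m x) <= 4 * mu * N2 x.

Lemma crouzeix_sq_affine {n} (M : 'M[C]_n.+1) a s :
  crouzeix_sq M -> crouzeix_sq (a%:M + s *: M).
Proof.
move=> crM p mu pmu x; rewrite horner_mx_affine; apply: crM => z.
move=> /numerical_rangeP[y y1 zE]; rewrite horner_comp !hornerE; apply: pmu.
apply/numerical_rangeP; exists y => //; rewrite mulmxDr mulmxDl mxE -scalemxAr -scalemxAl.
rewrite mul_mx_scalar -scalemxAl [in RHS]mxE N2_adj y1 mulr1 addrC zE; congr (_ + _).
by rewrite [in RHS]mxE.
Qed.

Lemma crouzeix_sq_unitary {n} (U M N : 'M[C]_n.+1) :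
  adjmx U *m U = 1%:M -> U *m M = N *m U -> crouzeix_sq N -> crouzeix_sq M.
Proof.
move=> UU UM crN p mu pmu x.
rewrite -(N2_unitary _ _ UU) -[N2 x](N2_unitary _ _ UU) mulmxA (horner_mx_intertwine _ _ _ _ UM).
rewrite -mulmxA; apply: crN => z /numerical_rangeP[y y1 zE]; apply: pmu.
have UU' : U *m adjmx U = 1%:M by apply: mulmx1C.
apply/numerical_rangeP; exists (adjmx U *m y).
  by rewrite N2_unitary // adjmxK.
by rewrite adjmxM adjmxK !mulmxA -[_ *m U *m M]mulmxA UM !mulmxA -[_ *m U *m adjmx U]mulmxA UU' mulmx1.
Qed.

Lemma bilinear_bound {n} (A : 'M[C]_n) (k : R) : 0 <= k ->
  (forall x, N2 (A *m x) <= k * N2 x) -> forall y, N2 (A^T *m y) <= k * N2 y.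
Proof.
move=> k0 Ak y; pose x := map_mx conjc (A^T *m y).
have Nx : N2 x = N2 (A^T *m y) by apply: eq_bigr => i _; rewrite mxE nsq_conj.
have NE : (N2 x)%:C = \sum_i y i 0 * (A *m x) i 0.
  rewrite -N2_adj; transitivity ((y^T *m (A *m x)) 0 0).
    congr ((_ : 'M__) 0 0); rewrite mulmxA; congr (_ *m _).
    apply/matrixP => i j; rewrite ord1 !mxE conjcK; apply: eq_bigr => l _.
    by rewrite !mxE mulrC.
  by rewrite mxE; apply: eq_bigr => i _; rewrite mxE.
rewrite -Nx; have := N2_ge0 x; rewrite le_eqVlt => /orP[/eqP <-|x0].
  by rewrite mulr_ge0 ?N2_ge0.
pose ext (v : 'cV[C]_n) i := oapp (fun j : 'I_n => v j 0) 0 (insub i).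
have extE v (i : 'I_n) : ext v i = v i 0 by rewrite /ext valK.
have := @weighted_CauchySchwarz R (fun=> 1) (ext y) (ext (A *m x)) n (fun=> ltr01).
under eq_bigr do rewrite !extE.
under [X in _ <= X * _]eq_bigr do rewrite extE mul1r.
under [X in _ <= _ * X]eq_bigr do rewrite extE divr1.
rewrite -NE nsq_real -!/(N2 _) => /le_trans/(_ (ler_wpM2l (N2_ge0 y) (Ak x))).
by rewrite expr2 mulrCA mulrA ler_pM2r // mulrC.
Qed.

Lemma crouzeix_sq_tr {n} (M : 'M[C]_n.+1) : crouzeix_sq M^T -> crouzeix_sq M.
Proof.
move=> crM p mu pmu; have mu0 : 0 <= mu.
  pose e : 'cV[C]_n.+1 := delta_mx 0 0.
  apply: le_trans (nsq_ge0 _) (pmu ((adjmx e *m M *m e) 0 0) _).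
  apply/numerical_rangeP; exists e => //.
  rewrite /N2 (bigD1 0) //= mxE eqxx nsq_real expr1n big1 ?addr0 // => i i0.
  by rewrite mxE (negbTE i0) nsq0.
rewrite -[horner_mx M p]trmxK -horner_mx_tr; apply: bilinear_bound => [|y].
  by rewrite mulr_ge0.
apply: crM => z /numerical_rangeP[v v1 zE]; apply: pmu; apply/numerical_rangeP.
exists (map_mx conjc v).
  by rewrite -v1; apply: eq_bigr => i _; rewrite mxE nsq_conj.
have tr00 (B : 'M[C]_1) : B 0 0 = B^T 0 0 by rewrite mxE.
rewrite zE tr00 !trmx_mul trmxK mulmxA.
congr ((_ *m _ *m _ : 'M__) 0 0); apply/matrixP => i j; rewrite !mxE //.
by rewrite conjcK.
Qed.
End Crouzeix.

Section Attained.
Import numFieldTopology.Exports numFieldNormedType.Exports.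
Context {R : realType}.
Local Notation C := R[i].
Local Notation "z ^c" := (conjc z) (at level 1, format "z ^c").
Local Notation Re := (@complex.Re _).
Local Notation Im := (@complex.Im _).
Implicit Types (z w : C) (p q f : {poly C}).

Definition ccontinuous {T : topologicalType} (F : T -> C) :=
  continuous (fun t => Re (F t)) /\ continuous (fun t => Im (F t)).

Section Closure.
Context {T : topologicalType}.
Implicit Types F G : T -> C.

Lemma ccontinuous_cst c : ccontinuous (fun _ : T => c).
Proof. by split=> t; exact: cst_continuous. Qed.

Lemma ccontinuousD F G : ccontinuous F -> ccontinuous G -> ccontinuous (fun t => F t + G t).
Proof.
move=> [F1 F2] [G1 G2]; split=> t.
- have -> : (fun t => Re (F t + G t)) = (fun t => Re (F t)) \+ (fun t => Re (G t)).
    by apply/funext => u /=; case: (F u) (G u) => [? ?] [? ?].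
  by apply: continuousD; [exact: F1|exact: G1].
- have -> : (fun t => Im (F t + G t)) = (fun t => Im (F t)) \+ (fun t => Im (G t)).
    by apply/funext => u /=; case: (F u) (G u) => [? ?] [? ?].
  by apply: continuousD; [exact: F2|exact: G2].
Qed.

Lemma ccontinuousM F G : ccontinuous F -> ccontinuous G -> ccontinuous (fun t => F t * G t).
Proof.
move=> [F1 F2] [G1 G2]; split=> t.
- have -> : (fun t => Re (F t * G t)) =
      ((fun t => Re (F t)) \* (fun t => Re (G t))) \- ((fun t => Im (F t)) \* (fun t => Im (G t))).
    by apply/funext => u /=; case: (F u) (G u) => [? ?] [? ?].
  by apply: continuousB; apply: continuousM;
    [exact: F1|exact: G1|exact: F2|exact: G2].
- have -> : (fun t => Im (F t * G t)) =
      ((fun t => Re (F t)) \* (fun t => Im (G t))) \+ ((fun t => Im (F t)) \* (fun t => Re (G t))).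
    by apply/funext => u /=; case: (F u) (G u) => [? ?] [? ?].
  by apply: continuousD; apply: continuousM;
    [exact: F1|exact: G2|exact: F2|exact: G1].
Qed.

Lemma ccontinuous_conj F : ccontinuous F -> ccontinuous (fun t => (F t)^c).
Proof.
move=> [F1 F2]; split=> t.
- have -> : (fun t => Re (F t)^c) = (fun t => Re (F t)) by apply/funext => u /=; case: (F u).
  exact: F1.
- have -> : (fun t => Im (F t)^c) = \- (fun t => Im (F t)) by apply/funext => u /=; case: (F u).
  by apply: continuousN; exact: F2.
Qed.

Lemma ccontinuous_sum n (F : 'I_n -> T -> C) : (forall i, ccontinuous (F i)) ->
  ccontinuous (fun t => \sum_i F i t).
Proof.
elim: n F => [|n IH] F cF.
  by under eq_fun do rewrite big_ord0; exact: ccontinuous_cst.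
under eq_fun do rewrite big_ord_recl.
by apply: ccontinuousD => //; apply: IH.
Qed.

Lemma ccontinuous_horner F p : ccontinuous F -> ccontinuous (fun t => p.[F t]).
Proof.
move=> cF; elim/poly_ind: p => [|p c IH].
  by under eq_fun do rewrite horner0; exact: ccontinuous_cst.
under eq_fun do rewrite hornerMXaddC.
by apply: ccontinuousD (ccontinuous_cst _); apply: ccontinuousM.
Qed.

Lemma ccontinuous_nsq F : ccontinuous F -> continuous (fun t => nsq (F t)).
Proof.
move=> cF; have [cre _] := ccontinuousM _ _ cF (ccontinuous_conj _ cF).
by move: cre; under eq_fun do rewrite -nsqC.
Qed.

End Closure.

Lemma crouzeix_sq_ineq {n} (M : 'M[C]_n.+1) p : crouzeix_sq M -> crouzeix_ineq M p.
Proof.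
move=> crM; pose N := (n.+1 + n.+1)%N.
pose V (v : 'rV[R]_N) : 'cV[C]_n.+1 := \col_i (v 0 (lshift _ i) +i* v 0 (rshift _ i)).
pose A : set 'rV[R]_N := [set v | N2 (V v) = 1]%classic.
pose F (v : 'rV[R]_N) := (adjmx (V v) *m M *m V v) 0 0.
have cV i : ccontinuous (fun v => V v i 0).
  by split=> v; under eq_fun do rewrite mxE /=; exact: coord_continuous.
have cF : ccontinuous F.
  rewrite /F; under eq_fun do rewrite mxE; apply: ccontinuous_sum => i.
  apply: ccontinuousM => //; under eq_fun do rewrite mxE; apply: ccontinuous_sum => j.
  apply: ccontinuousM (ccontinuous_cst _).
  have -> : (fun v => adjmx (V v) 0 j) = (fun v => (V v j 0)^c).
    by apply/funext => v; rewrite /adjmx [LHS]mxE [X in X^c]mxE.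
  by apply: ccontinuous_conj.
have cN2 : continuous (fun v => N2 (V v)).
  have [+ _] : ccontinuous (fun v => \sum_i V v i 0 * (V v i 0)^c).
    by apply: ccontinuous_sum => i; apply: ccontinuousM => //; apply: ccontinuous_conj.
  have -> // : (fun v => Re (\sum_i V v i 0 * (V v i 0)^c)) = (fun v => N2 (V v)).
  by apply/funext => v; under eq_bigr do rewrite -nsqC; rewrite -(rmorph_sum (real_complex R)).
have VE (x : 'cV[C]_n.+1) : exists v, V v = x.
  exists (row_mx (\row_i Re (x i 0)) (\row_i Im (x i 0))).
  apply/matrixP => i j; rewrite ord1 mxE row_mxEl row_mxEr !mxE.
  by case: (x i 0).
have e1 : N2 (delta_mx 0 0 : 'cV[C]_n.+1) = 1.
  rewrite /N2 (bigD1 0) //= mxE eqxx nsq_real expr1n big1 ?addr0 // => i i0.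
  by rewrite mxE (negbTE i0) nsq0.
have A0 : (A !=set0)%classic.
  by have [v vE] := VE (delta_mx 0 0); exists v; rewrite /A /= vE.
have cA : compact A.
  pose B : set 'rV[R]_N := [set v | forall i, `[-1, 1]%classic (v ord0 i)]%classic.
  have := @subclosed_compact _ A B; apply.
  - apply: preimage_closed (@closed_eq _ 1) => v _; exact: cN2.
  - refine (@rV_compact R N (fun=> `[-1, 1]%classic) _) => i; exact (@segment_compact R (-1) 1).
  - move=> v vA i; have le1 (x : R) : x ^+ 2 <= 1 -> x \in `[-1, 1].
      by move=> x1; rewrite in_itv /= -ler_norml -(@expr_le1 _ 2) // real_normK ?num_real.
    apply: le1; rewrite -vA /N2; case: (fintype.split_ordP i) => j ->; rewrite (bigD1 j) //= mxE /nsq /=.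
      by rewrite -addrA lerDl addr_ge0 ?sqr_ge0 // sumr_ge0 // => k _; exact: nsq_ge0.
    by rewrite addrAC lerDr addr_ge0 ?sqr_ge0 // sumr_ge0 // => k _; exact: nsq_ge0.
have cf : {within A, continuous (fun v => nsq p.[F v])}%classic.
  by apply: continuous_subspaceT; apply: ccontinuous_nsq; apply: ccontinuous_horner.
have [v] := compact_EVT_max A0 cA cf; rewrite inE => vA vmax.
exists (cmod p.[F v]).
  split.
    by exists (F v) => //; apply/numerical_rangeP; exists (V v).
  move=> _ [z /numerical_rangeP[x x1 zE] <-]; have [u uE] := VE x.
  rewrite -ler_sqr ?nnegrE ?cmod_ge0 // !cmod_sqr zE -uE; apply: vmax.
  by rewrite inE /A /= uE.
apply: ge_sup => [|_ [x x1 <-]].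
  exists (norm2 (horner_mx M p *m delta_mx 0 0)), (delta_mx 0 0) => //.
  by apply/eqP; rewrite -(@pexpr_eq1 _ _ 2) ?sqrtr_ge0 // N2_norm e1.
rewrite -ler_sqr ?nnegrE ?sqrtr_ge0 ?mulr_ge0 ?cmod_ge0 // exprMn cmod_sqr N2_norm.
have -> : 2 ^+ 2 * nsq p.[F v] = 4 * nsq p.[F v] * N2 x.
  by rewrite -N2_norm x1; ring.
apply: crM => z /numerical_rangeP[y y1 ->]; have [u uE] := VE y.
by rewrite -uE; apply: vmax; rewrite inE /A /= uE.
Qed.
End Attained.

(** * Monomials on the circle and Chebyshev polynomials on ellipses *)

Section Chebyshev.
Context {R : realType}.
Local Notation C := R[i].
Local Notation "z ^c" := (conjc z) (at level 1, format "z ^c").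
Local Notation Re := (@complex.Re _).
Local Notation Im := (@complex.Im _).
Implicit Types (z w : C) (p q f : {poly C}).

Lemma complex_prim_root n : (0 < n)%N -> exists w : C, n.-primitive_root w.
Proof.
move=> n_gt0; pose p : {poly C} := 'X^n - 1.
have [r Dp] := closed_field_poly_normal p; move: Dp.
rewrite (monicP (monicXnsubC 1 n_gt0)) scale1r => Dp.
have rn1 : all n.-unity_root r by apply/allP => z; rewrite -root_prod_XsubC -Dp.
have sz_r : (n < (size r).+1)%N.
  by rewrite -(size_prod_XsubC r id) -Dp size_XnsubC.
have uniq_r : uniq r.
  by rewrite -separable_prod_XsubC -Dp separable_Xn_sub_1 // pnatr_eq0 -lt0n.
have [z _ prim_z] := hasP (has_prim_root n_gt0 rn1 uniq_r sz_r).
by exists z.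
Qed.

Lemma nsq_unity_root n w : (0 < n)%N -> w ^+ n = 1 -> w * w^c = 1.
Proof.
move=> n0 wn; rewrite -nsqC; have nsqX k : nsq (w ^+ k) = nsq w ^+ k.
  by elim: k => [|k IH]; rewrite ?expr0 ?nsq_real ?expr1n // !exprS nsqM IH.
suff -> : nsq w = 1 by [].
have /eqP := nsqX n; rewrite wn nsq_real expr1n eq_sym => /eqP wn1.
by apply/eqP; rewrite -(pexpr_eq1 n0 (nsq_ge0 _)) wn1.
Qed.

Lemma sum_prim_root n w k : n.-primitive_root w ->
  \sum_(j < n) (w ^+ k) ^+ j = if (n %| k)%N then n%:R else 0.
Proof.
move=> prw; case: ifP => [nk|nk].
  have -> : w ^+ k = 1 by apply/eqP; rewrite -(prim_order_dvd prw).
  by rewrite (eq_bigr (fun=> 1)) ?sumr_const ?card_ord // => j _; rewrite expr1n.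
have wk1 : w ^+ k - 1 != 0 by rewrite subr_eq0 -(prim_order_dvd prw) nk.
apply: (mulfI wk1); rewrite -subrX1 mulr0 -exprM mulnC exprM.
by rewrite (prim_expr_order prw) expr1n subrr.
Qed.

Lemma sum_prim_root_conj n w k l : n.-primitive_root w -> (k < n)%N -> (l < n)%N ->
  \sum_(j < n) (w ^+ j) ^+ k * ((w ^+ j) ^+ l)^c = if k == l then n%:R else 0.
Proof.
move=> prw kn ln; have n0 := prim_order_gt0 prw.
have ww := nsq_unity_root _ _ n0 (prim_expr_order prw).
wlog kl : k l kn ln / (l <= k)%N.
  move=> H; case: (leqP l k) => [lk|/ltnW kl]; first exact: H.
  rewrite -[LHS]conjcK rmorph_sum /= (eq_bigr (fun j : 'I_n => (w ^+ j) ^+ l * ((w ^+ j) ^+ k)^c)).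
    by rewrite H // eq_sym; case: eqP; rewrite ?conjc_nat ?conjc0.
  by move=> j _; rewrite rmorphM /= conjcK mulrC.
have -> : \sum_(j < n) (w ^+ j) ^+ k * ((w ^+ j) ^+ l)^c = \sum_(j < n) (w ^+ (k - l)) ^+ j.
  apply: eq_bigr => j _; rewrite -{1}(subnK kl) exprD -mulrA !conjcX.
  by rewrite -!exprMn ww !expr1n mulr1 -!exprM mulnC.
rewrite (sum_prim_root _ _ _ prw); case: (eqVneq k l) => [->|nkl]; first by rewrite subnn dvdn0.
case: ifP => // /dvdn_leq; rewrite subn_gt0 ltn_neqAle eq_sym nkl kl => /(_ isT).
by rewrite leqNgt (leq_ltn_trans (leq_subr _ _) kn).
Qed.

Lemma spans_monomials : spans (fun n => 'X^n : {poly C}).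
Proof. by move=> q; exists (size q), (fun n => q`_n); rewrite -{1}[q]coefK poly_def. Qed.

Lemma orthogonal_monomials (W : set C) : (forall w, w * w^c = 1 -> W w) ->
  orthogonal_on W (fun n => 'X^n) (fun=> 1).
Proof.
move=> circW D; have [w prw] := complex_prim_root D.+1 isT.
exists D, (fun j => w ^+ j); split=> [j|n m nD mD].
  apply: circW; rewrite conjcX -exprMn.
  by rewrite (nsq_unity_root _ _ _ (prim_expr_order prw)) ?expr1n.
under eq_bigr do rewrite !hornerXn.
rewrite (sum_prim_root_conj _ _ _ _ prw) ?(ltn_trans _ (ltnSn _)) // mulr1.
by case: eqP => // _; rewrite rmorph_nat.
Qed.

Fixpoint cheb_pair n : {poly C} * {poly C} :=
  if n is n'.+1 then let: (s, t) := cheb_pair n' in (t, 2%:R *: ('X * t) - s)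
  else (1, 'X).

Definition cheb n := (cheb_pair n).1.

Lemma cheb_pair_snd n : (cheb_pair n).2 = cheb n.+1.
Proof. by rewrite /cheb /=; case: (cheb_pair n). Qed.

Lemma chebS n : cheb n.+2 = 2%:R *: ('X * cheb n.+1) - cheb n.
Proof. by rewrite -!cheb_pair_snd /cheb /=; case: (cheb_pair n). Qed.

Lemma cheb0 : cheb 0 = 1. Proof. by []. Qed.
Lemma cheb1 : cheb 1 = 'X. Proof. by []. Qed.

Lemma horner_cheb n w : w != 0 -> (cheb n).[(w + w^-1) / 2] = (w ^+ n + w^-1 ^+ n) / 2.
Proof.
move=> w0; suff: (cheb n).[(w + w^-1) / 2] = (w ^+ n + w^-1 ^+ n) / 2 /\
  (cheb n.+1).[(w + w^-1) / 2] = (w ^+ n.+1 + w^-1 ^+ n.+1) / 2 by case.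
elim: n => [|n [IH IH1]].
  rewrite cheb0 cheb1 !hornerE !expr0 !expr1; by split; [field|].
split=> //; rewrite chebS hornerD hornerN hornerZ hornerM hornerX IH IH1 !exprS.
by field.
Qed.

Lemma spans_cheb : spans cheb.
Proof.
pose Q q := exists D (a : nat -> C), q = \sum_(n < D) a n *: cheb n.
have QD q1 q2 : Q q1 -> Q q2 -> Q (q1 + q2).
  move=> [D1 [a1 ->]] [D2 [a2 ->]]; exists (maxn D1 D2).
  pose c (a : nat -> C) D n : C := if (n < D)%N then a n else 0.
  exists (fun n => c a1 D1 n + c a2 D2 n).
  under [RHS]eq_bigr do rewrite scalerDl.
  rewrite big_split /=; have wide (a : nat -> C) D : (D <= maxn D1 D2)%N ->
      \sum_(n < D) a n *: cheb n = \sum_(n < maxn D1 D2) c a D n *: cheb n.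
    move=> DD; rewrite (@sum_ord_widen _ (fun n => c a D n *: cheb n) _ _ DD) => [|n].
      by apply: eq_bigr => n _; rewrite /c ltn_ord.
    by rewrite /c leqNgt => /negbTE ->; rewrite scale0r.
  by rewrite -!wide ?leq_maxl ?leq_maxr.
have QZ c q : Q q -> Q (c *: q).
  move=> [D [a ->]]; exists D, (fun n => c * a n).
  by rewrite scaler_sumr; apply: eq_bigr => n _; rewrite scalerA.
have Qcheb n : Q (cheb n).
  exists n.+1, (fun k => (k == n)%:R); rewrite big_ord_recr /= eqxx scale1r big1 ?add0r // => k _.
  by rewrite ltn_eqF ?scale0r.
have QX q : Q q -> Q ('X * q).
  move=> [D [a ->]]; elim: D => [|D IH].
    by exists 0%N, a; rewrite !big_ord0 mulr0.
  rewrite big_ord_recr mulrDr; apply: (QD) => //=; rewrite -scalerAr; apply: (QZ).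
  case: D {IH} => [|D]; first by rewrite cheb0 mulr1; exact: (Qcheb 1%N).
  have -> : 'X * cheb D.+1 = 2^-1 *: (cheb D.+2 + cheb D).
    by rewrite chebS addrNK scalerA mulVf ?pnatr_eq0 // scale1r.
  by apply: (QZ); apply: (QD).
have Q0 : Q 0 by exists 0%N, (fun=> 0); rewrite big_ord0.
elim/poly_ind => [//|q c Qq]; apply: (QD); first by rewrite mulrC; apply: QX.
by rewrite -[c%:P]mulr1 mul_polyC; apply: (QZ); exact: (Qcheb 0).
Qed.

Definition cheb_weight (r : R) n : R :=
  if n is 0 then 1 else (r ^+ n ^+ 2 + r^-1 ^+ n ^+ 2) / 4.

Lemma orthogonal_cheb (W : set C) (r : R) : 0 < r ->
  (forall w, w * w^c = 1 -> W ((r%:C * w + (r%:C * w)^-1) / 2)) ->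
  orthogonal_on W cheb (cheb_weight r).
Proof.
move=> r0 ellW D; have [w prw] := complex_prim_root D.*2.+1 isT.
have rC : r%:C != 0 :> C by rewrite eq_complex /= gt_eqF.
have ww := nsq_unity_root _ _ (ltn0Sn _) (prim_expr_order prw).
have wj j : (w ^+ j) * (w ^+ j)^c = 1 by rewrite conjcX -exprMn ww expr1n.
exists D.*2, (fun j => (r%:C * w ^+ j + (r%:C * w ^+ j)^-1) / 2); split=> [j|n m nD mD].
  exact: ellW.
have w0 j : w ^+ j != 0 by apply/eqP => wj0; have := wj j; rewrite wj0 mul0r => /esym/eqP; rewrite oner_eq0.
have wV j : (w ^+ j)^-1 = (w ^+ j)^c by apply: (mulfI (w0 j)); rewrite wj divff.
have lt2 k : (k < D)%N -> (k < D.*2.+1)%N by move=> kD; rewrite ltnS -addnn ltnW // ltn_addr.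
pose F k l j := (w ^+ j) ^+ k * ((w ^+ j) ^+ l)^c.
have S0 k l : (k < D.*2.+1)%N -> (l < D.*2.+1)%N ->
  \sum_(j < D.*2.+1) F k l j = if k == l then D.*2.+1%:R else 0.
  by move=> *; apply: sum_prim_root_conj.
pose P k : C := (r ^+ k)%:C; pose N k : C := (r^-1 ^+ k)%:C.
have Pconj k : (P k)^c = P k by exact: conjc_real.
have Nconj k : (N k)^c = N k by exact: conjc_real.
have nm : (n + m < D.*2.+1)%N by rewrite ltnS -addnn leq_add // ltnW.
have chebE k j : (cheb k).[(r%:C * w ^+ j + (r%:C * w ^+ j)^-1) / 2] =
    (P k * (w ^+ j) ^+ k + N k * ((w ^+ j) ^+ k)^c) / 2.
  rewrite horner_cheb ?mulf_neq0 // invfM wV !exprMn.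
  by rewrite /P /N !rmorphXn /= fmorphV.
transitivity (\sum_(j < D.*2.+1) (P n * P m / 4 * F n m j + N n * N m / 4 * F m n j +
   (P n * N m / 4 * F (n + m)%N 0%N j + N n * P m / 4 * F 0%N (n + m)%N j))).
  apply: eq_bigr => j _; rewrite !chebE /F expr0 conjc1 exprD.
  rewrite !(conjcM, conjcD, conjc_inv) Pconj Nconj conjcK conjc1.
  by field.
rewrite !big_split -4!mulr_sumr /= (S0 n m) ?lt2 // (S0 m n) ?lt2 // (S0 (n + m) 0)%N //.
rewrite (S0 0 (n + m))%N // (eq_sym m n) (eq_sym 0%N).
case: (eqVneq n m) => [<-|nm']; last first.
  have -> : ((n + m)%N == 0%N) = false.
    by rewrite addn_eq0; apply: contraNF nm' => /andP[/eqP -> /eqP ->].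
  by rewrite !mulr0 !addr0.
case: n nD nm {mD} => [|n] nD nm; rewrite rmorphM rmorph_nat /=.
  by rewrite /P /N /= !expr0; field.
rewrite /P /N /cheb_weight fmorph_div rmorphD !rmorphXn rmorph_nat /=.
by field.
Qed.

End Chebyshev.

Definition o0 : 'I_3 := @Ordinal 3 0 isT.
Definition o1 : 'I_3 := @Ordinal 3 1 isT.
Definition o2 : 'I_3 := @Ordinal 3 2 isT.

Lemma sum3 {V : nmodType} (F : 'I_3 -> V) : \sum_i F i = F o0 + F o1 + F o2.
Proof.
rewrite !big_ord_recr /= big_ord0 add0r.
by congr (F _ + F _ + F _); apply: val_inj.
Qed.

Lemma forall3 (P : 'I_3 -> Prop) : P o0 -> P o1 -> P o2 -> forall i, P i.
Proof.
move=> P0 P1 P2 [[|[|[|//]]] i3];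
  [rewrite (_ : Ordinal i3 = o0)|rewrite (_ : Ordinal i3 = o1)|rewrite (_ : Ordinal i3 = o2)];
  by [|apply: val_inj].
Qed.

Section ThreeByThree.
Context {R : realType}.
Local Notation C := R[i].
Local Notation "z ^c" := (conjc z) (at level 1, format "z ^c").
Local Notation Re := (@complex.Re _).
Local Notation Im := (@complex.Im _).
Implicit Types (z w : C) (p q f : {poly C}).

Definition mx3 (a00 a01 a02 a10 a11 a12 a20 a21 a22 : C) : 'M[C]_3 :=
  \matrix_(i < 3, j < 3)
    (nth [::] [:: [:: a00; a01; a02]; [:: a10; a11; a12]; [:: a20; a21; a22]] i)`_j.

Definition cv3 (x0 x1 x2 : C) : 'cV[C]_3 := \col_(i < 3) [:: x0; x1; x2]`_i.

Lemma cv3_0 x0 x1 x2 : cv3 x0 x1 x2 o0 0 = x0. Proof. by rewrite mxE. Qed.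
Lemma cv3_1 x0 x1 x2 : cv3 x0 x1 x2 o1 0 = x1. Proof. by rewrite mxE. Qed.
Lemma cv3_2 x0 x1 x2 : cv3 x0 x1 x2 o2 0 = x2. Proof. by rewrite mxE. Qed.
Definition cv3E := (cv3_0, cv3_1, cv3_2).

Lemma cv3Z w x0 x1 x2 : w *: cv3 x0 x1 x2 = cv3 (w * x0) (w * x1) (w * x2).
Proof. by apply/matrixP => i j; rewrite ord1; elim/forall3: i; rewrite !mxE. Qed.

Lemma N2_3 (x : 'cV[C]_3) : N2 x = nsq (x o0 0) + nsq (x o1 0) + nsq (x o2 0).
Proof. exact: sum3. Qed.

Lemma mx3_mulv a00 a01 a02 a10 a11 a12 a20 a21 a22 (x : 'cV[C]_3) :
  mx3 a00 a01 a02 a10 a11 a12 a20 a21 a22 *m x =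
  cv3 (a00 * x o0 0 + a01 * x o1 0 + a02 * x o2 0)
      (a10 * x o0 0 + a11 * x o1 0 + a12 * x o2 0)
      (a20 * x o0 0 + a21 * x o1 0 + a22 * x o2 0).
Proof.
by apply/matrixP => i j; rewrite ord1 !mxE sum3; elim/forall3: i; rewrite !mxE.
Qed.

Lemma mx3_mul a00 a01 a02 a10 a11 a12 a20 a21 a22 b00 b01 b02 b10 b11 b12 b20 b21 b22 :
  mx3 a00 a01 a02 a10 a11 a12 a20 a21 a22 *m mx3 b00 b01 b02 b10 b11 b12 b20 b21 b22 =
  mx3 (a00 * b00 + a01 * b10 + a02 * b20) (a00 * b01 + a01 * b11 + a02 * b21)
      (a00 * b02 + a01 * b12 + a02 * b22)
      (a10 * b00 + a11 * b10 + a12 * b20) (a10 * b01 + a11 * b11 + a12 * b21)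
      (a10 * b02 + a11 * b12 + a12 * b22)
      (a20 * b00 + a21 * b10 + a22 * b20) (a20 * b01 + a21 * b11 + a22 * b21)
      (a20 * b02 + a21 * b12 + a22 * b22).
Proof.
apply/matrixP => i j; rewrite !mxE sum3.
by elim/forall3: i; elim/forall3: j; rewrite !mxE.
Qed.

Lemma mx3_eta (A : 'M[C]_3) : A = mx3 (A o0 o0) (A o0 o1) (A o0 o2)
  (A o1 o0) (A o1 o1) (A o1 o2) (A o2 o0) (A o2 o1) (A o2 o2).
Proof. by apply/matrixP => i j; elim/forall3: i; elim/forall3: j; rewrite mxE. Qed.

Lemma mx3_scalar c : c%:M = mx3 c 0 0 0 c 0 0 0 c.
Proof. by apply/matrixP => i j; elim/forall3: i; elim/forall3: j; rewrite !mxE. Qed.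

Lemma mx3_adj a00 a01 a02 a10 a11 a12 a20 a21 a22 :
  adjmx (mx3 a00 a01 a02 a10 a11 a12 a20 a21 a22) =
  mx3 a00^c a10^c a20^c a01^c a11^c a21^c a02^c a12^c a22^c.
Proof. by apply/matrixP => i j; elim/forall3: i; elim/forall3: j; rewrite !mxE. Qed.

Lemma numerical_range3 (M : 'M[C]_3) (x : 'cV[C]_3) : N2 x = 1 ->
  numerical_range M ((x o0 0)^c * (M *m x) o0 0 + (x o1 0)^c * (M *m x) o1 0
                     + (x o2 0)^c * (M *m x) o2 0).
Proof.
move=> x1; apply/numerical_rangeP; exists x => //.
have adjE j i : adjmx x j i = (x i 0)^c by rewrite !mxE ord1.
by rewrite -mulmxA [RHS]mxE sum3 !adjE.
Qed.

Lemma eigen_in_range {n} (M : 'M[C]_n) (v : 'cV[C]_n) w : v != 0 -> M *m v = w *: v ->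
  numerical_range M w.
Proof.
move=> v0 Mv; have Nv : N2 v != 0 by apply: contra v0 => /eqP/N2_eq0 ->.
have Nv0 : 0 < N2 v by rewrite lt_neqAle eq_sym Nv N2_ge0.
pose k := (Num.sqrt (N2 v))^-1.
have k2 : k ^+ 2 * N2 v = 1 by rewrite exprVn sqr_sqrtr ?mulVf ?N2_ge0.
apply/numerical_rangeP; exists (k%:C *: v); first by rewrite N2Z nsq_real.
rewrite -mulmxA -scalemxAr Mv scalerA -scalemxAr mxE.
have -> : adjmx (k%:C *: v) = k%:C *: adjmx v.
  by apply/matrixP => i j; rewrite !mxE conjcM conjc_real.
rewrite -scalemxAl mxE N2_adj.
have : (k%:C * k%:C * (N2 v)%:C : C) = 1.
  by rewrite -!rmorphM /= -expr2 k2.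
by move: (k%:C) => t tE; rewrite -[LHS]mulr1 -tE; ring.
Qed.

Lemma scalar_row_functional (M : 'M[C]_3) (x : 'cV[C]_3) i :
  scalar (fun p => (horner_mx M p *m x) i 0).
Proof.
by move=> c p q; rewrite rmorphD /= horner_mxZ mulmxDl -scalemxAl !mxE.
Qed.

Lemma N2_diag_horner (d : 'rV[C]_3) p (mu : R) x : (forall i, nsq p.[d 0 i] <= mu) ->
  N2 (horner_mx (diag_mx d) p *m x) <= mu * N2 x.
Proof.
move=> pd; rewrite horner_mx_diag mul_diag_mx /N2 mulr_sumr; apply: ler_sum => i _.
by rewrite !mxE nsqM ler_wpM2r ?nsq_ge0.
Qed.

End ThreeByThree.

(** * The elliptic model *)

Section Model.
Context {R : realType}.
Local Notation C := R[i].
Local Notation "z ^c" := (conjc z) (at level 1, format "z ^c").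
Local Notation Re := (@complex.Re _).
Local Notation Im := (@complex.Im _).
Implicit Types (z w : C) (p q f : {poly C}) (r c s : R).

Lemma nsq_comb3 (a b c : R) (x y z : C) :
  nsq (a%:C * x + b%:C * y + c%:C * z) =
  (a * Re x + b * Re y + c * Re z) ^+ 2 + (a * Im x + b * Im y + c * Im z) ^+ 2.
Proof. by case: x => x1 x2; case: y => y1 y2; case: z => z1 z2; rewrite /nsq /=; ring. Qed.

(* r - 1/r and r + 1/r are the lengths of the axes of the elliptic range, whose
   foci are the eigenvalues 1 and -1. *)
Definition model r c s : 'M[C]_3 :=
  mx3 0 (r * c)%:C (s / r)%:C (c / r)%:C 0 0 (r * s)%:C 0 0.

Lemma model_symmetrizable r c s : 1 <= r -> r ^+ 2 <= 2 -> c ^+ 2 + s ^+ 2 = 1 ->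
  crouzeix_sq (model r c s).
Proof.
move=> r1 r2 cs p mu pmu x; have r0 : 0 < r by lra.
have rn0 : r != 0 by rewrite gt_eqF.
pose k : R := (Num.sqrt 2)^-1.
have k2 : 2 * k ^+ 2 = 1 by rewrite exprVn sqr_sqrtr // divff // pnatr_eq0.
pose X : 'M[C]_3 := mx3 0%:C (- (s * r))%:C (c / r)%:C
  k%:C (k * c * r)%:C (k * s / r)%:C k%:C (- (k * c * r))%:C (- (k * s / r))%:C.
pose d : 'rV[C]_3 := \row_i [:: 0; 1; -1]`_i.
have dE : diag_mx d = mx3 0 0 0 0 1 0 0 0 (-1).
  by apply/matrixP => i j; elim/forall3: i; elim/forall3: j; rewrite !mxE.
have XN : X *m model r c s = diag_mx d *m X.
  rewrite dE !mx3_mul; congr mx3; apply/eqP; rewrite eq_complex /=; apply/andP;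
    split; apply/eqP; try by field.
  - by transitivity (k * (c ^+ 2 + s ^+ 2)); [field|rewrite cs; ring].
  - by transitivity (- k * (c ^+ 2 + s ^+ 2)); [field|rewrite cs; ring].
have XE (v : 'cV[C]_3) : N2 (X *m v) = nsq (v o0 0) + r ^+ 2 * nsq (v o1 0) + r ^- 2 * nsq (v o2 0).
  have real_id (a0 a1 a2 : R) : (0 * a0 + - (s * r) * a1 + c / r * a2) ^+ 2
    + (k * a0 + k * c * r * a1 + k * s / r * a2) ^+ 2
    + (k * a0 + - (k * c * r) * a1 + - (k * s / r) * a2) ^+ 2
    = a0 ^+ 2 + r ^+ 2 * a1 ^+ 2 + r ^- 2 * a2 ^+ 2.
    transitivity ((c ^+ 2 + s ^+ 2) * (r ^+ 2 * a1 ^+ 2 + r ^- 2 * a2 ^+ 2) + 2 * k ^+ 2 * a0 ^+ 2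
       + (2 * k ^+ 2 - 1) * (c * r * a1 + s / r * a2) ^+ 2); first by field.
    by rewrite k2 cs; ring.
  rewrite mx3_mulv N2_3 !cv3E !nsq_comb3 /nsq.
  have := real_id (Re (v o0 0)) (Re (v o1 0)) (Re (v o2 0)).
  have := real_id (Im (v o0 0)) (Im (v o1 0)) (Im (v o2 0)); lra.
have rV0 : 0 < r ^- 2 by rewrite invr_gt0 exprn_gt0.
have rr1 : 1 <= r ^+ 2 by rewrite exprn_ege1.
have rV1 : r ^- 2 <= 1 by rewrite invf_le1 // exprn_gt0.
have weigh (a n0 n1 n2 : R) : 1 <= a -> 0 < a^-1 -> a^-1 <= 1 -> 0 <= n0 -> 0 <= n1 -> 0 <= n2 ->
    a^-1 * (n0 + n1 + n2) <= n0 + a * n1 + a^-1 * n2 <= a * (n0 + n1 + n2).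
  move=> a1 aV0 aV1 n00 n10 n20; have := mulr_ge0 (_ : 0 <= a - 1) n00.
  have := mulr_ge0 (_ : 0 <= 1 - a^-1) n00; have := mulr_ge0 (_ : 0 <= a - a^-1) n10.
  have := mulr_ge0 (_ : 0 <= a - a^-1) n20; rewrite !subr_ge0.
  by move=> /(_ (le_trans aV1 a1)) + /(_ (le_trans aV1 a1)) + /(_ aV1) + /(_ a1); lra.
have Xbounds v := weigh (r ^+ 2) _ _ _ rr1 rV0 rV1 (nsq_ge0 (v o0 0)) (nsq_ge0 (v o1 0)) (nsq_ge0 (v o2 0)).
have {}Xbounds v : r ^- 2 * N2 v <= N2 (X *m v) <= r ^+ 2 * N2 v by rewrite XE N2_3.
rewrite -(ler_pM2l rV0); apply: (le_trans (proj1 (andP (Xbounds _)))).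
rewrite mulmxA (horner_mx_intertwine _ _ _ _ XN) -mulmxA.
have pd : forall i, nsq p.[d 0 i] <= mu.
  have model_eigen lam a0 a1 a2 : (a0 != 0) || (a1 != 0) || (a2 != 0) ->
      r * c * a1 + s / r * a2 = lam * a0 -> c / r * a0 = lam * a1 -> r * s * a0 = lam * a2 ->
      numerical_range (model r c s) lam%:C.
    move=> a_neq0 e0 e1 e2; apply: (@eigen_in_range _ _ _ (cv3 a0%:C a1%:C a2%:C)).
      apply: contraL a_neq0 => /eqP/matrixP av; rewrite !negb_or !negbK.
      by move: (av o0 0) (av o1 0) (av o2 0); rewrite !cv3E !mxE => -[->] [->] [->]; rewrite eqxx.
    rewrite mx3_mulv !cv3E cv3Z; congr cv3; rewrite !mul0r ?add0r ?addr0 -!rmorphM /=.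
    - by rewrite -rmorphD e0.
    - by rewrite e1.
    - by rewrite e2.
  apply: forall3; rewrite mxE; apply: pmu.
  - apply: (model_eigen 0 0 (- (s / r)) (r * c)); [|by field..].
    rewrite oppr_eq0 !mulf_eq0 invr_eq0 (negbTE rn0) eqxx orbF /= -negb_and.
    by apply: contra_eqN cs => /andP[/eqP -> /eqP ->]; rewrite expr0n addr0 eq_sym oner_eq0.
  - apply: (model_eigen 1 1 (c / r) (r * s)); rewrite ?oner_eq0 ?mul1r ?mulr1 // -cs.
    by field.
  - have := model_eigen (-1) 1 (- (c / r)) (- (r * s)); rewrite rmorphN; apply; rewrite ?oner_eq0 ?mulN1r ?opprK ?mulr1 // -cs.
    by field.
apply: (le_trans (N2_diag_horner _ _ _ _ pd)).
have mu0 : 0 <= mu by exact: le_trans (nsq_ge0 _) (pd o0).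
have r4 : r ^+ 2 <= r ^- 2 * 4.
  by rewrite mulrC ler_pdivlMr ?exprn_gt0 // -expr2 -[4]/((2 * 2)%:R) natrM -expr2 ler_sqr ?nnegrE //; lra.
have -> : r ^- 2 * (4 * mu * N2 x) = mu * (r ^- 2 * 4 * N2 x) by ring.
apply: ler_wpM2l => //; apply: (le_trans (proj2 (andP (Xbounds _)))).
by rewrite ler_wpM2r ?N2_ge0.
Qed.
End Model.

#[local] Arguments cheb_weight : simpl never.

Section Weights.
Context {R : realType}.
Local Notation C := R[i].
Implicit Types (r c s x y : R).

Lemma cheb_weight0 r : cheb_weight r 0 = 1. Proof. by []. Qed.

Lemma cheb_weight_gt0 r n : 0 < r -> 0 < cheb_weight r n.
Proof.
move=> r0; rewrite /cheb_weight; case: n => [|n] //.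
by rewrite divr_gt0 // addr_gt0 // !exprn_gt0 // invr_gt0.
Qed.

Lemma cheb_weightV r n : 0 < r -> (0 < n)%N ->
  (cheb_weight r n)^-1 = 4 * (r ^- 2 ^+ n / (1 + r ^- 2 ^+ n ^+ 2)).
Proof.
move=> r0; case: n => // n _; rewrite /cheb_weight.
have -> : r ^- 2 ^+ n.+1 = r^-1 ^+ n.+1 ^+ 2 by rewrite -exprVn -!exprM mulnC.
rewrite exprVn; have := exprn_gt0 n.+1 r0; move: (r ^+ n.+1) => a a0.
have ? : a ^+ 4 + 1 != 0 by rewrite gt_eqF // ltr_pwDl ?exprn_gt0.
by field; rewrite gt_eqF //= -exprM.
Qed.

Lemma cheb_weightV_le r n : 0 < r -> (0 < n)%N -> (cheb_weight r n)^-1 <= 4 * r ^- 2 ^+ n.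
Proof.
move=> r0 n0; rewrite cheb_weightV //; have y0 : 0 < r ^- 2 ^+ n by rewrite exprn_gt0 // invr_gt0 exprn_gt0.
rewrite ler_pM2l // ler_pdivrMr; last by rewrite ltr_pwDl // sqr_ge0.
by rewrite ler_peMr ?lerDl ?sqr_ge0 // ltW.
Qed.

Lemma inv_pair_ge1 x : 0 <= x -> x <= 1 -> 1 <= (1 + x)^-1 + x / (1 + x ^+ 3).
Proof.
move=> x0 x1; have -> : (1 + x)^-1 = 1 - x / (1 + x) by field; lra.
have : x / (1 + x) <= x / (1 + x ^+ 3).
  have p1 : 0 < 1 + x by lra.
  have p3 : 0 < 1 + x ^+ 3 by rewrite ltr_pwDl // exprn_ge0.
  rewrite ler_wpM2l // lef_pV2 ?posrE //.
  by rewrite lerD2l exprS ler_piMr // expr_le1.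
lra.
Qed.

Lemma inv_pair_le x : 0 <= x -> (1 + x)^-1 + x / (1 + x ^+ 3) <= 1 + x ^+ 2.
Proof.
move=> x0; have : (1 + x)^-1 <= 1 - x + x ^+ 2.
  rewrite -[leLHS]mul1r ler_pdivrMr; last by lra.
  by have := exprn_ge0 3 x0; lra.
have : x / (1 + x ^+ 3) <= x.
  by rewrite ler_pdivrMr ?ler_peMr ?lerDl ?exprn_ge0 // ltr_pwDl // exprn_ge0.
lra.
Qed.

Section Sums.
Variables (r : R) (F : nat -> R) (t0 t1 t2 : R).
Hypotheses (r0 : 0 < r) (r2 : 2 <= r ^+ 2) (t00 : 0 <= t0) (t10 : 0 <= t1) (t20 : 0 <= t2).
Hypotheses (F0 : forall k, F (k * 4)%N = t0) (F1 : forall k, F (k * 4).+1 = t1)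
  (F2 : forall k, F (k * 4).+2 = t2) (F3 : forall k, F (k * 4).+3 = t1).
Variables y x : R.
Hypotheses (yE : y = r ^- 2) (xE : x = y ^+ 2).

Lemma y_bounds : 0 < y <= 1 / 2.
Proof.
by rewrite yE invr_gt0 exprn_gt0 //= mul1r lef_pV2 ?posrE // exprn_gt0.
Qed.

Lemma x_bounds : 0 < x <= 1 / 4.
Proof.
have /andP[y0 y1] := y_bounds; rewrite xE exprn_gt0 //=.
have : y * y <= 1 / 2 * (1 / 2) by rewrite ler_pM // ltW.
by rewrite expr2; lra.
Qed.

Lemma cheb_sum_ge :
  (1 + 3 * x ^+ 2) * t0 + 4 * y * t1 + 4 * x * t2 <= \sum_(n < 7) F n / cheb_weight r n.
Proof.
have /andP[y0 y1] := y_bounds; have /andP[x0 x1] := x_bounds.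
rewrite !big_ord_recr big_ord0 /= add0r.
rewrite (F0 0) (F1 0) (F2 0) (F3 0) (F0 1) (F1 1) (F2 1) cheb_weight0 divr1 !cheb_weightV // -yE.
have y3 : y ^+ 3 = y * x by rewrite xE; ring.
have y4 : y ^+ 4 = x ^+ 2 by rewrite xE; ring.
have y6 : y ^+ 6 = x ^+ 3 by rewrite xE; ring.
have y32 : (y * x) ^+ 2 = x ^+ 3 by rewrite xE; ring.
have x32 : (x ^+ 3) ^+ 2 = x ^+ 2 ^+ 3 by ring.
rewrite expr1 y3 y4 y6 -xE y32 x32.
have /andP[x20 x2] : 0 <= x ^+ 2 <= 1 / 16.
  rewrite sqr_ge0 /=; have : x * x <= 1 / 4 * (1 / 4) by rewrite ler_pM // ltW.
  by rewrite expr2; lra.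
have x21 : x ^+ 2 <= 1 by lra.
have x11 : x <= 1 by lra.
have h0 : 3 * x ^+ 2 * t0 <= t0 * (4 * (x ^+ 2 / (1 + x ^+ 2 ^+ 2))).
  rewrite mulrC ler_wpM2l // mulrA ler_pdivlMr; last by rewrite ltr_pwDl // sqr_ge0.
  have : x ^+ 2 * x ^+ 2 <= x ^+ 2 * (1 / 16) by rewrite ler_wpM2l; lra.
  by rewrite [x ^+ 2 ^+ 2]expr2; nra.
have h1 := ler_wpM2l (mulr_ge0 (mulr_ge0 (ler0n R 4) (ltW y0)) t10) (inv_pair_ge1 _ (ltW x0) x11).
have h2 := ler_wpM2l (mulr_ge0 (mulr_ge0 (ler0n R 4) (ltW x0)) t20) (inv_pair_ge1 _ (sqr_ge0 x) x21).
have h5 : 0 <= t1 * (4 * (y ^+ 5 / (1 + y ^+ 5 ^+ 2))).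
  by rewrite !mulr_ge0 ?invr_ge0 ?addr_ge0 ?exprn_ge0 //; exact: ltW.
have e1 : t1 * (4 * (y / (1 + x))) + t1 * (4 * (y * x / (1 + x ^+ 3)))
   = 4 * y * t1 * ((1 + x)^-1 + x / (1 + x ^+ 3)) by ring.
have e2 : t2 * (4 * (x / (1 + x ^+ 2))) + t2 * (4 * (x ^+ 3 / (1 + x ^+ 2 ^+ 3)))
   = 4 * x * t2 * ((1 + x ^+ 2)^-1 + x ^+ 2 / (1 + x ^+ 2 ^+ 3)) by ring.
lra.
Qed.

Lemma cheb_block_sum D : \sum_(n < D * 4) F n / cheb_weight r n =
  \sum_(k < D) (t0 / cheb_weight r (k * 4) + t1 / cheb_weight r (k * 4).+1
    + t2 / cheb_weight r (k * 4).+2 + t1 / cheb_weight r (k * 4).+3).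
Proof.
elim: D => [|D IH]; first by rewrite mul0n !big_ord0.
by rewrite [RHS]big_ord_recr /= -IH mulSn !add4n !big_ord_recr /= F0 F1 F2 F3 !addrA.
Qed.

Lemma cheb_sum_le D : \sum_(n < D) F n / cheb_weight r n <=
  (1 + 64 / 15 * x ^+ 2) * t0 + 4 * y * (1 + 3 * x ^+ 2) * t1 + 4 * x * (1 + 3 * x ^+ 2) * t2.
Proof.
have /andP[y0 y1] := y_bounds; have /andP[x0 x1] := x_bounds.
have F_ge0 n : 0 <= F n.
  by rewrite (divn_eq n 4); case: (n %% 4)%N (ltn_pmod n (isT : 0 < 4)%N) => [|[|[|[|//]]]] _;
    rewrite ?addn0 ?addn1 ?addn2 ?addn3 ?F0 ?F1 ?F2 ?F3.
have w_ge0 n : 0 <= F n / cheb_weight r n by rewrite divr_ge0 // ltW // cheb_weight_gt0.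
have /andP[x20 x2] : 0 <= x ^+ 2 <= 1 / 16.
  rewrite sqr_ge0 /=; have : x * x <= 1 / 4 * (1 / 4) by rewrite ler_pM // ltW.
  by rewrite expr2; lra.
pose tail := 64 / 15 * t0 + 16 / 3 * y * t1 + 64 / 15 * x * t2.
have tail0 : 0 <= tail by rewrite /tail !addr_ge0 // ?mulr_ge0 //; lra.
suff main : \sum_(n < D.+1 * 4) F n / cheb_weight r n + x ^+ 2 ^+ D.+1 * tail <=
    (1 + 64 / 15 * x ^+ 2) * t0 + 4 * y * (1 + 3 * x ^+ 2) * t1 + 4 * x * (1 + 3 * x ^+ 2) * t2.
  apply: le_trans main; have DD : (D <= D.+1 * 4)%N by rewrite (leq_trans (leqnSn D)) // leq_pmulr.
  rewrite (big_ord_widen _ (fun n => F n / cheb_weight r n) DD) /= ler_wpDr //.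
    by rewrite mulr_ge0 // exprn_ge0 // sqr_ge0.
  rewrite [leRHS](bigID (fun n : 'I__ => (n < D)%N)) /= lerDl.
  by apply: sumr_ge0 => n _.
rewrite cheb_block_sum; elim: D => [|D IH].
  rewrite big_ord_recr big_ord0 /= mul0n add0r expr1 cheb_weight0 divr1 !cheb_weightV // -yE -xE.
  have y3 : y ^+ 3 = y * x by rewrite xE; ring.
  have y32 : (y * x) ^+ 2 = x ^+ 3 by rewrite xE; ring.
  rewrite expr1 y3 y32.
  have h1 := ler_wpM2l (mulr_ge0 (mulr_ge0 (ler0n R 4) (ltW y0)) t10) (inv_pair_le _ (ltW x0)).
  have h2 : t2 * (4 * (x / (1 + x ^+ 2))) <= 4 * x * t2.
    rewrite [leRHS]mulrC ler_wpM2l // ler_wpM2l // ler_pdivrMr ?ler_peMr ?lerDl ?sqr_ge0 //; first exact: ltW.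
    by rewrite ltr_pwDl // sqr_ge0.
  have e1 : t1 * (4 * (y / (1 + x))) + t1 * (4 * (y * x / (1 + x ^+ 3)))
     = 4 * y * t1 * ((1 + x)^-1 + x / (1 + x ^+ 3)) by ring.
  have yt1 : 0 <= x ^+ 2 * (y * t1) by rewrite !mulr_ge0 // ?ltW //; lra.
  have xt2 : 0 <= x ^+ 2 * (x * t2) by rewrite !mulr_ge0 // ?ltW //; lra.
  rewrite /tail; lra.
apply: le_trans IH; rewrite big_ord_recr /= -addrA lerD2l.
set q := x ^+ 2 ^+ D.+1; have q0 : 0 <= q by rewrite exprn_ge0 // sqr_ge0.
have yq : y ^+ (D.+1 * 4) = q by rewrite mulnC exprM (_ : y ^+ 4 = x ^+ 2) // xE; ring.
have w0 := ler_wpM2l t00 (cheb_weightV_le r (D.+1 * 4) r0 isT).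
have w1 := ler_wpM2l t10 (cheb_weightV_le r (D.+1 * 4).+1 r0 isT).
have w2 := ler_wpM2l t20 (cheb_weightV_le r (D.+1 * 4).+2 r0 isT).
have w3 := ler_wpM2l t10 (cheb_weightV_le r (D.+1 * 4).+3 r0 isT).
rewrite -yE yq in w0; rewrite -yE -[X in _ ^+ X]addn1 exprD yq in w1.
rewrite -yE -[X in _ ^+ X]addn2 exprD yq in w2; rewrite -yE -[X in _ ^+ X]addn3 exprD yq in w3.
rewrite [x ^+ 2 ^+ D.+2]exprS -/q /tail.
have a0 : 0 <= q * t0 by rewrite mulr_ge0.
have a1 : 0 <= q * (y * t1) by rewrite !mulr_ge0 // ltW.
have a2 : 0 <= q * (x * t2) by rewrite !mulr_ge0 // ltW.
have b0 := ler_wpM2r a0 x2.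
have b1 := ler_wpM2r a1 x2.
have b2 := ler_wpM2r a2 x2.
have b3 := ler_wpM2r a1 x1.
have e2 : t2 * (4 * (q * y ^+ 2)) = 4 * (q * (x * t2)) by rewrite xE; ring.
have e3 : t1 * (4 * (q * y ^+ 3)) = 4 * (x * (q * (y * t1))) by rewrite xE; ring.
lra.
Qed.

End Sums.
End Weights.

Section ModelRange.
Context {R : realType}.
Local Notation C := R[i].
Local Notation "z ^c" := (conjc z) (at level 1, format "z ^c").
Local Notation Re := (@complex.Re _).
Local Notation Im := (@complex.Im _).
Implicit Types (z w : C) (p q f : {poly C}) (r c s : R).

Lemma model_range r c s w : 0 < r -> c ^+ 2 + s ^+ 2 = 1 -> w * w^c = 1 ->
  numerical_range (model r c s) ((r%:C * w + (r%:C * w)^-1) / 2).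
Proof.
move=> r0 cs ww; have rn0 : r%:C != 0 :> C by rewrite eq_complex /= gt_eqF.
have w0 : w != 0 by apply/eqP => w0; move: ww; rewrite w0 mul0r => /eqP; rewrite eq_sym oner_eq0.
have wV : w^-1 = w^c by apply: (mulfI w0); rewrite ww divff.
have [k k2] : exists k : R, k ^+ 2 = 1 / 2.
  by exists (Num.sqrt 2)^-1; rewrite exprVn sqr_sqrtr // mul1r.
have nw : nsq w = 1 by apply: (@complexI R); rewrite nsqC ww.
pose x := cv3 k%:C (k%:C * c%:C * w) (k%:C * s%:C * w^c).
have x1 : N2 x = 1.
  rewrite N2_3 !cv3E !nsqM nsq_conj nw !nsq_real k2.
  by transitivity ((1 + (c ^+ 2 + s ^+ 2)) / 2); [field|rewrite cs; field].
have := numerical_range3 (model r c s) x x1.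
rewrite mx3_mulv !cv3E !conjcM conjcK !conjc_real invfM wV.
congr numerical_range; rewrite !rmorphM /= !fmorphV /=.
have kC : (k%:C * k%:C : C) = 1 / 2 by rewrite -rmorphM -expr2 k2 fmorph_div rmorph_nat rmorph1.
have csC : (c%:C * c%:C + s%:C * s%:C : C) = 1 by rewrite -!rmorphM -rmorphD -!expr2 cs.
transitivity (k%:C * k%:C * ((c%:C * c%:C + s%:C * s%:C) * (r%:C * w + r%:C^-1 * w^c))).
  by field.
by rewrite kC csC; field.
Qed.

Lemma cheb_cube (A : 'M[C]_3) k : A *m A *m A = A ->
  [/\ horner_mx A (cheb (k * 4)) = 1, horner_mx A (cheb (k * 4).+1) = A,
      horner_mx A (cheb (k * 4).+2) = 2%:R *: (A *m A) - 1
    & horner_mx A (cheb (k * 4).+3) = A].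
Proof.
move=> A3; have step n : horner_mx A (cheb n.+2) =
    2%:R *: (A *m horner_mx A (cheb n.+1)) - horner_mx A (cheb n).
  by rewrite chebS rmorphB /= horner_mxZ rmorphM /= horner_mx_X.
have A3' : A *m (A *m A) = A by rewrite mulmxA.
have two (B : 'M[C]_3) : 2%:R *: B = B + B by rewrite scaler_nat mulr2n.
have step4 n : horner_mx A (cheb n) = 1 -> horner_mx A (cheb n.+1) = A ->
    horner_mx A (cheb n.+2) = 2%:R *: (A *m A) - 1 /\ horner_mx A (cheb n.+3) = A.
  move=> e0 e1; have e2 : horner_mx A (cheb n.+2) = 2%:R *: (A *m A) - 1.
    by rewrite step e0 e1.
  split=> //; rewrite step e2 e1 mulmxBr -scalemxAr A3' mulmx1 !two.
  by rewrite !addrK.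
elim: k => [|k [e0 e1 e2 e3]].
  have e0 : horner_mx A (cheb 0) = 1 by rewrite cheb0 rmorph1.
  have e1 : horner_mx A (cheb 1) = A by rewrite cheb1 horner_mx_X.
  by have [] := step4 0%N e0 e1.
have e4 : horner_mx A (cheb (k.+1 * 4)) = 1.
  rewrite mulSn (_ : (4 + k * 4 = (k * 4).+4)%N) // step e3 e2.
  by rewrite opprB addrCA subrr addr0.
have e5 : horner_mx A (cheb (k.+1 * 4).+1) = A.
  rewrite mulSn (_ : ((4 + k * 4).+1 = (k * 4).+4.+1)%N) // step e3.
  by rewrite -(_ : (k.+1 * 4 = (k * 4).+4)%N) // e4 mulmx1 two addrK.
by have [] := step4 _ e4 e5.
Qed.

Section Fixed.
Variables (r c s y x : R).
Hypotheses (r0 : 0 < r) (r2 : 2 <= r ^+ 2) (cs1 : c ^+ 2 + s ^+ 2 = 1) (sc : s ^+ 2 <= c ^+ 2).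
Hypotheses (yE : y = r ^- 2) (xE : x = y ^+ 2).
Let N := model r c s.
Let T2 := 2%:R *: (N *m N) - 1.

Lemma model_cube : N *m N *m N = N.
Proof.
have rn0 : r != 0 by rewrite gt_eqF.
rewrite /N /model !mx3_mul; congr mx3; apply/eqP; rewrite eq_complex /=; apply/andP;
  split; apply/eqP; try by field.
- by transitivity (r * c * (c ^+ 2 + s ^+ 2)); [field|rewrite cs1; ring].
- by transitivity (s / r * (c ^+ 2 + s ^+ 2)); [field|rewrite cs1; ring].
- by transitivity (c / r * (c ^+ 2 + s ^+ 2)); [field|rewrite cs1; ring].
- by transitivity (r * s * (c ^+ 2 + s ^+ 2)); [field|rewrite cs1; ring].
Qed.

Definition row_norm k0 k1 k2 i (v : 'cV[C]_3) : R :=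
  k0 * nsq (v i 0) + k1 * nsq ((N *m v) i 0) + k2 * nsq ((T2 *m v) i 0).

Lemma model_row_bound p (mu : R) v i :
  (forall z, numerical_range N z -> nsq p.[z] <= mu) ->
  row_norm (1 + 3 * x ^+ 2) (4 * y) (4 * x) i (horner_mx N p *m v) <=
  mu * row_norm (1 + 64 / 15 * x ^+ 2) (4 * y * (1 + 3 * x ^+ 2)) (4 * x * (1 + 3 * x ^+ 2)) i v.
Proof.
move=> pmu; pose phi q := (horner_mx N q *m v) i 0.
have lphi : scalar phi by apply: scalar_row_functional.
pose G (u : 'cV[C]_3) n := nsq ((horner_mx N (cheb n) *m u) i 0).
have Gmod u k : [/\ G u (k * 4)%N = nsq (u i 0), G u (k * 4).+1 = nsq ((N *m u) i 0),
    G u (k * 4).+2 = nsq ((T2 *m u) i 0) & G u (k * 4).+3 = nsq ((N *m u) i 0)].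
  by have [e0 e1 e2 e3] := cheb_cube N k model_cube; rewrite /G e0 e1 e2 e3 mul1mx.
have G0 u k : G u (k * 4)%N = nsq (u i 0) by have [] := Gmod u k.
have G1 u k : G u (k * 4).+1 = nsq ((N *m u) i 0) by have [] := Gmod u k.
have G2 u k : G u (k * 4).+2 = nsq ((T2 *m u) i 0) by have [] := Gmod u k.
have G3 u k : G u (k * 4).+3 = nsq ((N *m u) i 0) by have [] := Gmod u k.
pose g := horner_mx N p *m v.
have low := cheb_sum_ge r (G g) _ _ _ r0 r2 (nsq_ge0 _) (nsq_ge0 _) (nsq_ge0 _) (G0 g) (G1 g) (G2 g) (G3 g) y x yE xE.
have up D := cheb_sum_le r (G v) _ _ _ r0 r2 (nsq_ge0 _) (nsq_ge0 _) (nsq_ge0 _) (G0 v) (G1 v) (G2 v) (G3 v) y x yE xE D.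
apply: (le_trans low).
have orth : orthogonal_on (numerical_range N) cheb (cheb_weight r).
  by apply: orthogonal_cheb => // w; apply: model_range.
have mu0 : 0 <= mu.
  apply: le_trans (nsq_ge0 _) (pmu _ (model_range r c s 1 r0 cs1 _)).
  by rewrite mul1r conjc1.
have [E] := dual_norm_mul (fun n => cheb_weight_gt0 r n r0) spans_cheb orth p mu pmu phi lphi 7.
move=> /le_trans/(_ (ler_wpM2l mu0 (up E))).
congr (_ <= _); apply: eq_bigr => n _; congr (nsq _ / _).
by rewrite /phi rmorphM /= -mulmxE -mulmxA.
Qed.

End Fixed.
End ModelRange.

Section ModelBound.
Context {R : realType}.
Local Notation C := R[i].
Local Notation "z ^c" := (conjc z) (at level 1, format "z ^c").
Local Notation Re := (@complex.Re _).
Local Notation Im := (@complex.Im _).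
Implicit Types (r c s : R).

(* Weighted sum of the dual norms of the last row (weight 1) and the first
   row (weight (c^2 - s^2)^2) of the model, with y = r^-2; these weights make the
   lower estimate at least k times, and the upper estimate at most 4 k times, the
   squared norm. *)
Definition quad c s y k0 k p0 p1 p2 : R :=
  k0 * p2 ^+ 2 + 4 * k * (s * p0) ^+ 2
  + 4 * k * (2 * c * s * p1 - y * (c ^+ 2 - s ^+ 2) * p2) ^+ 2
  + (c ^+ 2 - s ^+ 2) ^+ 2 * (k0 * p0 ^+ 2 + 4 * k * (c * p1 + y * s * p2) ^+ 2
      + 4 * y ^+ 2 * k * p0 ^+ 2).

Lemma quadE c s y k0 k p0 p1 p2 (sg := s ^+ 2) (u := c * s) (D := 1 - 2 * sg) :
  c ^+ 2 + s ^+ 2 = 1 -> quad c s y k0 k p0 p1 p2 =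
  k0 * p2 ^+ 2 + 4 * k * sg * p0 ^+ 2
  + 4 * k * (4 * sg * (1 - sg) * p1 ^+ 2 - 4 * u * y * D * p1 * p2 + y ^+ 2 * D ^+ 2 * p2 ^+ 2)
  + D ^+ 2 * (k0 * p0 ^+ 2 + 4 * k * ((1 - sg) * p1 ^+ 2 + 2 * y * u * p1 * p2 + y ^+ 2 * sg * p2 ^+ 2)
      + 4 * y ^+ 2 * k * p0 ^+ 2).
Proof.
move=> cs; have cE : c ^+ 2 = 1 - s ^+ 2 by rewrite -cs addrK.
have DE : c ^+ 2 - s ^+ 2 = D by rewrite cE /D /sg; ring.
rewrite /quad DE; have -> : (2 * c * s * p1 - y * D * p2) ^+ 2 =
  4 * sg * c ^+ 2 * p1 ^+ 2 - 4 * u * y * D * p1 * p2 + y ^+ 2 * D ^+ 2 * p2 ^+ 2.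
  by rewrite /sg /u; ring.
have -> : (c * p1 + y * s * p2) ^+ 2 = c ^+ 2 * p1 ^+ 2 + 2 * y * u * p1 * p2 + y ^+ 2 * sg * p2 ^+ 2.
  by rewrite /sg /u; ring.
by rewrite cE /sg; ring.
Qed.

Lemma quad_le c s y p0 p1 p2 (x := y ^+ 2) (k := 1 + 3 * x ^+ 2) :
  0 <= x <= 1 / 4 -> c ^+ 2 + s ^+ 2 = 1 -> s ^+ 2 <= c ^+ 2 ->
  quad c s y (1 + 64 / 15 * x ^+ 2) k p0 p1 p2 <= 4 * k * (p0 ^+ 2 + p1 ^+ 2 + p2 ^+ 2).
Proof.
move=> /andP[x0 x1] cs sc; rewrite quadE //; have sg0 := sqr_ge0 s.
rewrite -subr_ge0; set sg := s ^+ 2 in sc sg0 *; set u := c * s.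
have u2 : u ^+ 2 = sg * (1 - sg) by rewrite /u /sg -cs; ring.
have sg1 : sg <= 1 / 2 by rewrite /sg in sc *; lra.
set K := 1 + 64 / 15 * x ^+ 2; pose D := 1 - 2 * sg.
have x2 : x ^+ 2 <= 1 / 16.
  have : x * x <= 1 / 4 * (1 / 4) by rewrite ler_pM.
  by rewrite expr2; lra.
have x20 := sqr_ge0 x.
have k1 : 1 <= k by rewrite /k; lra.
have Kk : K <= 2 * k by rewrite /K /k; lra.
have xk : 8 * x * k <= 2 * k by rewrite ler_wpM2r; lra.
have xk0 : 0 <= x * k by rewrite mulr_ge0 //; lra.
have K0 : 0 <= K by rewrite /K; lra.
have p0c : 0 <= 4 * k * (1 - sg) - D ^+ 2 * (K + 4 * x * k).
  have D2 : D ^+ 2 <= 1 - sg.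
    have : 0 <= sg * (3 - 4 * sg) by rewrite mulr_ge0; lra.
    by rewrite /D; lra.
  have : D ^+ 2 * (K + 4 * x * k) <= (1 - sg) * (4 * k) by apply: ler_pM; rewrite ?sqr_ge0 //; lra.
  by lra.
have sq0 : 0 <= 4 * k * (s * D * p1 + y * c * (1 + 2 * sg) * p2) ^+ 2.
  by rewrite mulr_ge0 ?sqr_ge0 //; lra.
have sqE : (s * D * p1 + y * c * (1 + 2 * sg) * p2) ^+ 2 =
  sg * D ^+ 2 * p1 ^+ 2 + 2 * u * y * D * (1 + 2 * sg) * p1 * p2 + x * (1 - sg) * (1 + 2 * sg) ^+ 2 * p2 ^+ 2.
  have -> : 1 - sg = c ^+ 2 by rewrite -cs /sg addrK.
  by rewrite /sg /u /x; ring.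
rewrite {}sqE in sq0.
have t0 := mulr_ge0 p0c (sqr_ge0 p0).
have t2 : 0 <= (4 * k - K - 8 * x * k) * p2 ^+ 2 by rewrite mulr_ge0 ?sqr_ge0 //; lra.
apply: (le_trans (addr_ge0 (addr_ge0 t0 sq0) t2)).
by rewrite le_eqVlt; apply/orP; left; apply/eqP; rewrite /D /x; ring.
Qed.

Lemma quad_ge c s y p0 p1 p2 (x := y ^+ 2) (k := 1 + 3 * x ^+ 2) :
  0 <= x <= 1 / 4 -> c ^+ 2 + s ^+ 2 = 1 -> s ^+ 2 <= c ^+ 2 ->
  k * (p0 ^+ 2 + p1 ^+ 2 + p2 ^+ 2) <= quad c s y k 1 p0 p1 p2.
Proof.
move=> /andP[x0 x1] cs sc; rewrite quadE //; have sg0 := sqr_ge0 s.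
rewrite -subr_ge0; set sg := s ^+ 2 in sc sg0 *; set u := c * s.
have u2 : u ^+ 2 = sg * (1 - sg) by rewrite /u /sg -cs; ring.
have sg1 : sg <= 1 / 2 by rewrite /sg in sc *; lra.
pose D := 1 - 2 * sg; have x20 := sqr_ge0 x.
have x2 : x ^+ 2 <= x * (1 / 4) by rewrite expr2 ler_wpM2l.
have sg1' : 0 < 1 + sg by lra.
have p0c : 0 <= 4 * sg + D ^+ 2 * (k + 4 * x) - k.
  have : 0 <= (2 * sg - 5 / 2 * x) ^+ 2 by apply: sqr_ge0.
  have : 0 <= sg * (x * (1 / 4) - x ^+ 2) by rewrite mulr_ge0 // subr_ge0.
  have := mulr_ge0 x0 (sqr_ge0 (sg - 1 / 2)).
  have : 0 <= sg ^+ 2 * x ^+ 2 by rewrite mulr_ge0 // sqr_ge0.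
  have : 0 <= x * (1 / 4 - x) by rewrite mulr_ge0 // subr_ge0.
  by rewrite /D /k; nra.
have p1c : 0 <= (4 - k) * (1 + sg) - 8 * sg.
  have : k <= 19 / 16 by rewrite /k; lra.
  move=> k1; have : 0 <= (19 / 16 - k) * (1 + sg) by rewrite mulr_ge0; lra.
  by lra.
have sqE : ((1 + sg) * y * D * p2 - u * (1 + 2 * sg) * p1) ^+ 2 =
  (1 + sg) ^+ 2 * x * D ^+ 2 * p2 ^+ 2 - 2 * (1 + sg) * y * D * u * (1 + 2 * sg) * p1 * p2
   + sg * (1 - sg) * (1 + 2 * sg) ^+ 2 * p1 ^+ 2.
  by rewrite -u2 /x; ring.
have sq0 := sqr_ge0 ((1 + sg) * y * D * p2 - u * (1 + 2 * sg) * p1); rewrite {}sqE in sq0.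
have t0 := mulr_ge0 (mulr_ge0 (ltW sg1') p0c) (sqr_ge0 p0).
have t1 := mulr_ge0 p1c (sqr_ge0 p1).
rewrite -(pmulr_rge0 _ sg1'); apply: (le_trans (addr_ge0 (addr_ge0 t0 (mulr_ge0 (ler0n R 4) sq0)) t1)).
by rewrite le_eqVlt; apply/orP; left; apply/eqP; rewrite /D /x; ring.
Qed.

Lemma model_crouzeix_large r c s : 0 < r -> 2 <= r ^+ 2 -> c ^+ 2 + s ^+ 2 = 1 -> s ^+ 2 <= c ^+ 2 ->
  crouzeix_sq (model r c s).
Proof.
move=> r0 r2 cs sc p mu pmu v; set N := model r c s.
pose y := r ^- 2; pose x := y ^+ 2; pose D := c ^+ 2 - s ^+ 2.
have x01 : 0 <= x <= 1 / 4.
  have /andP[h ->] := x_bounds r r0 r2 y x erefl erefl; by rewrite ltW.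
have rn0 : r != 0 by rewrite gt_eqF.
have rowsE k0 k (u : 'cV[C]_3) :
    row_norm r c s k0 (4 * y * k) (4 * x * k) o2 u + D ^+ 2 * row_norm r c s k0 (4 * y * k) (4 * x * k) o0 u =
    quad c s y k0 k (Re (u o0 0)) (Re (u o1 0)) (Re (u o2 0)) +
    quad c s y k0 k (Im (u o0 0)) (Im (u o1 0)) (Im (u o2 0)).
  have N2u : (N *m u) o2 0 = (r * s)%:C * u o0 0 + 0%:C * u o1 0 + 0%:C * u o2 0.
    by rewrite mx3_mulv cv3E.
  have N0u : (N *m u) o0 0 = 0%:C * u o0 0 + (r * c)%:C * u o1 0 + (s / r)%:C * u o2 0.
    by rewrite mx3_mulv cv3E.
  have TT i : ((2%:R *: (N *m N) - 1) *m u) i 0 = 2 * (N *m (N *m u)) i 0 - u i 0.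
    by rewrite mulmxBl mul1mx -scalemxAl mulmxA !mxE.
  have T2u : ((2%:R *: (N *m N) - 1) *m u) o2 0 =
     0%:C * u o0 0 + (2 * r ^+ 2 * c * s)%:C * u o1 0 + (- D)%:C * u o2 0.
    rewrite TT [N *m (N *m u)]mx3_mulv cv3E N0u; have -> : D = 1 - 2 * s ^+ 2.
      by rewrite /D (_ : c ^+ 2 = 1 - s ^+ 2); [ring|rewrite -cs addrK].
    move: (u o0 0) (u o1 0) (u o2 0) (N *m u) => [a0 b0] [a1 b1] [a2 b2] t.
    rewrite !mul0r !addr0; apply/eqP; rewrite eq_complex /=; apply/andP; split; apply/eqP; field; exact: rn0.
  have T0u : ((2%:R *: (N *m N) - 1) *m u) o0 0 = 1%:C * u o0 0 + 0%:C * u o1 0 + 0%:C * u o2 0.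
    rewrite TT [N *m (N *m u)]mx3_mulv cv3E N2u.
    have -> : (N *m u) o1 0 = (c / r)%:C * u o0 0 by rewrite mx3_mulv cv3E !mul0r !addr0.
    have rC : r%:C != 0 :> C by rewrite eq_complex /= gt_eqF.
    have csC : (c%:C ^+ 2 + s%:C ^+ 2 : C) = 1 by rewrite -!rmorphXn -rmorphD cs.
    rewrite !(rmorphM, rmorphD, rmorphN, rmorphXn, rmorph_nat, fmorphV, rmorph1) /=.
    transitivity (2 * (c%:C ^+ 2 + s%:C ^+ 2) * u o0 0 - u o0 0); first by field.
    by rewrite csC; ring.
  have realE p0 p1 p2 : quad c s y k0 k p0 p1 p2 =
      k0 * p2 ^+ 2 + 4 * y * k * (r * s * p0 + 0 * p1 + 0 * p2) ^+ 2
      + 4 * x * k * (0 * p0 + 2 * r ^+ 2 * c * s * p1 + - D * p2) ^+ 2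
      + D ^+ 2 * (k0 * p0 ^+ 2 + 4 * y * k * (0 * p0 + r * c * p1 + s / r * p2) ^+ 2
                  + 4 * x * k * (1 * p0 + 0 * p1 + 0 * p2) ^+ 2).
    by rewrite /quad -/D /x /y; field; exact: rn0.
  rewrite /row_norm -/N N2u N0u T2u T0u !nsq_comb3 /nsq !realE.
  by move: (r * s) (2 * r ^+ 2 * c * s) (r * c) (s / r) => *; ring.
have low i := model_row_bound r c s y x r0 r2 cs erefl erefl p mu v i pmu.
have mu0 : 0 <= mu.
  apply: le_trans (nsq_ge0 _) (pmu _ (model_range r c s 1 r0 cs _)).
  by rewrite mul1r conjc1.
pose k := 1 + 3 * x ^+ 2; have k0 : 0 < k by rewrite /k; have := sqr_ge0 x; lra.
have D20 := sqr_ge0 D; set g := horner_mx N p *m v in low *.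
have bound : quad c s y k 1 (Re (g o0 0)) (Re (g o1 0)) (Re (g o2 0)) +
    quad c s y k 1 (Im (g o0 0)) (Im (g o1 0)) (Im (g o2 0)) <=
    mu * (quad c s y (1 + 64 / 15 * x ^+ 2) k (Re (v o0 0)) (Re (v o1 0)) (Re (v o2 0)) +
      quad c s y (1 + 64 / 15 * x ^+ 2) k (Im (v o0 0)) (Im (v o1 0)) (Im (v o2 0))).
  rewrite -!rowsE !mulr1 [mu * (_ + _)]mulrDr.
  have b := lerD (low o2) (ler_wpM2l D20 (low o0)); rewrite -/k in b.
  by apply: (le_trans b); rewrite lerD2l mulrCA.
rewrite -(ler_pM2l k0); apply: (le_trans (_ : _ <= _)); last apply: (le_trans bound).
  rewrite N2_3 /nsq.
  have := quad_ge c s y (Re (g o0 0)) (Re (g o1 0)) (Re (g o2 0)) x01 cs sc.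
  have := quad_ge c s y (Im (g o0 0)) (Im (g o1 0)) (Im (g o2 0)) x01 cs sc.
  by rewrite -/x -/k; lra.
have -> : k * (4 * mu * N2 v) = mu * (4 * k * N2 v) by ring.
rewrite ler_wpM2l // N2_3 /nsq.
have := quad_le c s y (Re (v o0 0)) (Re (v o1 0)) (Re (v o2 0)) x01 cs sc.
have := quad_le c s y (Im (v o0 0)) (Im (v o1 0)) (Im (v o2 0)) x01 cs sc.
by rewrite -/x -/k; lra.
Qed.

End ModelBound.

(** * Discs *)

Section Disc.
Context {R : realType}.
Local Notation C := R[i].
Local Notation "z ^c" := (conjc z) (at level 1, format "z ^c").
Local Notation Re := (@complex.Re _).
Local Notation Im := (@complex.Im _).
Implicit Types (z w : C) (p q f : {poly C}).

Lemma geometric_limit (q a b c : R) : 0 <= q < 1 -> (forall J, a <= b + q ^+ J * c) -> a <= b.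
Proof.
move=> /andP[q0 q1] abc; rewrite leNgt; apply/negP => ba; pose h := 1 - q.
have h0 : 0 < h by rewrite subr_gt0.
have bern J : q ^+ J * (1 + J%:R * h) <= 1.
  elim: J => [|J IH]; first by rewrite expr0 mul0r addr0 mulr1.
  apply: le_trans IH; rewrite exprSr -mulrA ler_wpM2l ?exprn_ge0 //.
  have : 0 <= J.+1%:R * h ^+ 2 by rewrite mulr_ge0 ?sqr_ge0.
  by rewrite -natr1 /h; nra.
have d0 : 0 < a - b by rewrite subr_gt0.
have c0 : 0 <= c by have := abc 0; rewrite expr0 mul1r; lra.
have bound J : (a - b) * (1 + J%:R * h) <= c.
  have Jh : 0 <= 1 + J%:R * h by rewrite addr_ge0 // mulr_ge0 // ltW.
  have : (a - b) * (1 + J%:R * h) <= q ^+ J * c * (1 + J%:R * h).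
    by rewrite ler_wpM2r //; have := abc J; lra.
  move=> /le_trans; apply; rewrite mulrAC -[leRHS]mul1r ler_wpM2r //.
have dh : 0 < (a - b) * h by rewrite mulr_gt0.
have := archi_boundP (divr_ge0 c0 (ltW dh)); set J := Num.bound _.
by rewrite ltr_pdivrMr // => cJ; have := bound J; lra.
Qed.

(* Summing the defect P - P o A over the orbit of v telescopes, so that the dual
   norms of l1 and l2 for the monomials add up to P. *)
Lemma contraction_bound (A : 'M[C]_3) (l1 l2 : 'rV[C]_3) (w1 w2 : R) (P : 'cV[C]_3 -> R) :
  (forall w, w * w^c = 1 -> numerical_range A w) -> (forall v, 0 <= P v) -> 0 <= w1 -> 0 <= w2 ->
  (forall v, P v - P (A *m v) = w1 * nsq ((l1 *m v) 0 0) + w2 * nsq ((l2 *m v) 0 0)) ->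
  forall p (mu : R), (forall z, numerical_range A z -> nsq p.[z] <= mu) ->
  forall v J, P (horner_mx A p *m v) - P (A ^+ J *m (horner_mx A p *m v)) <= mu * P v.
Proof.
move=> circA P0 w10 w20 PA p mu pmu v J; set g := horner_mx A p *m v.
have mu0 : 0 <= mu.
  by apply: le_trans (nsq_ge0 _) (pmu 1 (circA _ _)); rewrite conjc1 mulr1.
have tele u E : P u - P (A ^+ E *m u) = w1 * (\sum_(n < E) nsq ((l1 *m (A ^+ n *m u)) 0 0))
    + w2 * (\sum_(n < E) nsq ((l2 *m (A ^+ n *m u)) 0 0)).
  elim: E => [|E IH]; first by rewrite expr0 mul1mx !big_ord0 subrr !mulr0 addr0.
  have := PA (A ^+ E *m u); rewrite !big_ord_recr /= exprS -mulmxE -mulmxA.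
  by move: IH; set X := nsq _; set Y := nsq _; lra.
pose phi (l : 'rV[C]_3) q := (l *m (horner_mx A q *m v)) 0 0.
have lphi l : scalar (phi l).
  by move=> c q1 q2; rewrite /phi rmorphD /= horner_mxZ mulmxDl -scalemxAl mulmxDr -scalemxAr !mxE.
have h1 : forall n : nat, 0 < (fun=> 1 : R) n by [].
have key l := dual_norm_mul h1 spans_monomials (orthogonal_monomials _ circA) p mu pmu (phi l) (lphi l) J.
have hX n : horner_mx A 'X^n = A ^+ n by rewrite rmorphXn /= horner_mx_X.
have [E1 K1] := key l1; have [E2 K2] := key l2; pose E := maxn E1 E2.
have mono l E' : (E' <= E)%N -> \sum_(n < E') nsq (phi l 'X^n) / 1 <= \sum_(n < E) nsq ((l *m (A ^+ n *m v)) 0 0).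
  move=> EE; rewrite (big_ord_widen _ (fun n => nsq (phi l 'X^n) / 1) EE) /=.
  rewrite [leRHS](bigID (fun n : 'I__ => (n < E')%N)) /= ler_wpDr //.
    by apply: sumr_ge0 => n _; apply: nsq_ge0.
  by rewrite le_eqVlt; apply/orP; left; apply/eqP; apply: eq_bigr => n _; rewrite divr1 /phi hX.
have low l : \sum_(n < J) nsq (phi l ('X^n * p)) / 1 = \sum_(n < J) nsq ((l *m (A ^+ n *m g)) 0 0).
  by apply: eq_bigr => n _; rewrite divr1 /phi rmorphM /= hX -mulmxE -mulmxA.
rewrite !low in K1 K2; rewrite tele.
have {}K1 := le_trans K1 (ler_wpM2l mu0 (mono l1 _ (leq_maxl _ _))).
have {}K2 := le_trans K2 (ler_wpM2l mu0 (mono l2 _ (leq_maxr _ _))).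
apply: (le_trans (lerD (ler_wpM2l w10 K1) (ler_wpM2l w20 K2))).
rewrite mulrCA [w2 * _]mulrCA -mulrDr ler_wpM2l // -tele lerBlDr lerDl.
exact: P0.
Qed.

Definition disc_model (a c d t : C) : 'M[C]_3 := mx3 0 0 0 a t 0 c d 0.

Lemma disc_crouzeix (a c d t : C) :
  nsq a + nsq c + nsq d = 4 -> t * (nsq a + nsq d)%:C = - (a * d * c^c) ->
  (forall w, w * w^c = 1 -> numerical_range (disc_model a c d t) w) ->
  crouzeix_sq (disc_model a c d t).
Proof.
move=> acd tS circA p mu pmu v; set A := disc_model a c d t; set g := horner_mx A p *m v.
pose S := nsq a + nsq d; have S0 : 0 <= S by rewrite addr_ge0 ?nsq_ge0.
have cE : nsq c = 4 - S by rewrite /S -acd; ring.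
have mu0 : 0 <= mu.
  by apply: le_trans (nsq_ge0 _) (pmu 1 (circA _ _)); rewrite conjc1 mulr1.
pose P k0 k1 (u : 'cV[C]_3) : R := k0 * nsq (u o0 0) + k1 * nsq (u o1 0) + 1 / 2 * nsq (u o2 0).
have P0 k0 k1 u : 0 <= k0 -> 0 <= k1 -> 0 <= P k0 k1 u.
  by move=> *; rewrite !addr_ge0 ?mulr_ge0 ?nsq_ge0 //; lra.
have A0 (u : 'cV[C]_3) : (A *m u) o0 0 = 0 by rewrite /A /disc_model mx3_mulv cv3E !mul0r !addr0.
have A1 (u : 'cV[C]_3) : (A *m u) o1 0 = a * u o0 0 + t * u o1 0 by rewrite /A /disc_model mx3_mulv cv3E mul0r addr0.
have A2 (u : 'cV[C]_3) : (A *m u) o2 0 = c * u o0 0 + d * u o1 0 by rewrite /A /disc_model mx3_mulv cv3E mul0r addr0.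
pose e2 : 'rV[C]_3 := delta_mx 0 o2.
have e2E (u : 'cV[C]_3) : (e2 *m u) 0 0 = u o2 0 by rewrite -rowE !mxE.
move: S0; rewrite le_eqVlt => /orP[/eqP/esym S_eq0|S_gt0].
  have [a0 d0] : a = 0 /\ d = 0.
    by move/eqP: S_eq0; rewrite paddr_eq0 ?nsq_ge0 // => /andP[/eqP/nsq_eq0 -> /eqP/nsq_eq0 ->].
  have c4 : nsq c = 4 by rewrite cE S_eq0 subr0.
  have A2' (u : 'cV[C]_3) : (A *m u) o2 0 = c * u o0 0 by rewrite A2 d0 mul0r addr0.
  have PA u : P 2 0 u - P 2 0 (A *m u) = 1 / 2 * nsq ((e2 *m u) 0 0) + 0 * nsq ((e2 *m u) 0 0).
    by rewrite /P e2E A0 A2' nsqM c4 nsq0; field.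
  have := contraction_bound A e2 e2 (1 / 2) 0 (P 2 0) circA _ _ (lexx 0) PA p mu pmu v 2.
  move=> /(_ (fun u => P0 _ _ u (ler0n R 2) (lexx 0))) /(_ ltac:(lra)).
  have -> : P 2 0 (A ^+ 2 *m (horner_mx A p *m v)) = 0.
    by rewrite expr2 -mulmxE -mulmxA /P A0 A2' A0 mulr0 nsq0; ring.
  rewrite subr0 -/g /P => bound.
  have g1 : g o1 0 = p.[t] * v o1 0.
    rewrite /g; elim/poly_ind: p {pmu g bound} v => [|q k IH] v.
      by rewrite rmorph0 mul0mx horner0 mul0r mxE.
    rewrite rmorphD rmorphM /= horner_mx_X horner_mx_C hornerMXaddC mulmxDl -mulmxE -mulmxA.
    rewrite mxE IH A1 a0 mul0r add0r mul_scalar_mx mxE; ring.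
  have tA : nsq p.[t] <= mu.
    apply: pmu; apply: (@eigen_in_range _ _ _ (cv3 0 1 0)).
      by apply/eqP => /matrixP/(_ o1 0); rewrite !mxE => /eqP; rewrite oner_eq0.
    by rewrite /A /disc_model mx3_mulv !cv3E cv3Z a0 d0; congr cv3; ring.
  have h1 : nsq (g o1 0) <= mu * nsq (v o1 0) by rewrite g1 nsqM ler_wpM2r ?nsq_ge0.
  have := mulr_ge0 mu0 (nsq_ge0 (v o0 0)); have := mulr_ge0 mu0 (nsq_ge0 (v o1 0)).
  have := mulr_ge0 mu0 (nsq_ge0 (v o2 0)); have := nsq_ge0 (g o0 0).
  by rewrite !N2_3; lra.
have Sn0 : S != 0 by rewrite gt_eqF.
have SC : S%:C != 0 :> C by rewrite eq_complex /= gt_eqF.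
have tE : t = - (a * d * c^c) / S%:C by rewrite -tS mulfK.
have t2 : nsq t * S ^+ 2 = nsq a * nsq d * nsq c.
  by rewrite tE -fmorphV !nsqM nsqN !nsqM nsq_conj nsq_real; field.
have t1 : nsq t < 1.
  have : nsq a * nsq d <= S ^+ 2 / 4 by have := sqr_ge0 (nsq a - nsq d); rewrite /S; lra.
  move=> /(ler_wpM2r (nsq_ge0 c)); rewrite -t2 cE => h.
  rewrite -(ltr_pM2r (exprn_gt0 2 S_gt0)) mul1r (le_lt_trans h) // mulrAC.
  by rewrite -mulrA gtr_pMr ?exprn_gt0 //; lra.
have A3 : A ^+ 3 = t *: A ^+ 2.
  rewrite !exprS expr0 mulr1 -!mulmxE /A /disc_model !mx3_mul.
  by apply/matrixP => i j; elim/forall3: i; elim/forall3: j; rewrite !mxE /=; ring.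
have AJ J : A ^+ (J + 2) = t ^+ J *: A ^+ 2.
  elim: J => [|J IH]; first by rewrite expr0 scale1r.
  by rewrite addSn exprS IH -scalerAr -exprS A3 scalerA -exprSr.
have PZ k0 k1 s u : P k0 k1 (s *: u) = nsq s * P k0 k1 u.
  by rewrite /P !mxE !nsqM; ring.
have limit (k1 : R) (l2 : 'rV[C]_3) (w2 : R) : 1 / 2 <= k1 <= 2 -> 0 <= w2 ->
    (forall u, P 2 k1 u - P 2 k1 (A *m u) = 1 / 2 * nsq ((e2 *m u) 0 0) + w2 * nsq ((l2 *m u) 0 0)) ->
    N2 g <= 4 * mu * N2 v.
  move=> /andP[k1l k1u] w20 PA; have Pge0 u : 0 <= P 2 k1 u by apply: P0; lra.
  have bound J := contraction_bound A e2 l2 (1 / 2) w2 (P 2 k1) circA Pge0 ltac:(lra) w20 PA p mu pmu v (J + 2).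
  have : P 2 k1 g <= mu * P 2 k1 v.
    apply: (@geometric_limit (nsq t) _ _ (P 2 k1 (A ^+ 2 *m g))); first by rewrite nsq_ge0.
    move=> J; have := bound J; rewrite AJ -/g -scalemxAl PZ.
    have -> : nsq (t ^+ J) = nsq t ^+ J.
      by elim: J => [|J IH]; rewrite ?expr0 ?nsq_real ?expr1n // !exprS nsqM IH.
    by lra.
  rewrite /P !N2_3 => h; have := nsq_ge0 (g o0 0); have := nsq_ge0 (v o0 0).
  have := nsq_ge0 (v o2 0); have := nsq_ge0 (g o2 0).
  have := mulr_ge0 (_ : 0 <= k1 - 1 / 2) (nsq_ge0 (g o1 0)); rewrite subr_ge0 => /(_ k1l).
  have := mulr_ge0 mu0 (mulr_ge0 (_ : 0 <= 2 - k1) (nsq_ge0 (v o1 0))); rewrite subr_ge0 => /(_ k1u).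
  have := mulr_ge0 mu0 (nsq_ge0 (v o2 0)).
  by lra.
pose m : 'rV[C]_3 := \row_i [:: 1; - (d * c^c / S%:C); 0]`_i.
have mE (u : 'cV[C]_3) : (m *m u) 0 0 = u o0 0 - d * c^c / S%:C * u o1 0.
  by rewrite mxE sum3 !mxE /=; ring.
have Am (u : 'cV[C]_3) : (A *m u) o1 0 = a * (m *m u) 0 0.
  by rewrite A1 mE tE; field.
have defect (u : 'cV[C]_3) : 2 * nsq (u o0 0) + 2 * nsq d / S * nsq (u o1 0) - 1 / 2 * nsq ((A *m u) o2 0)
    = S / 2 * nsq ((m *m u) 0 0).
  rewrite A2 mE -fmorphV.
  have expand (z1 u0 u1 : C) (k : R) : nsq (u0 - z1 * k%:C * u1) = nsq u0 + nsq z1 * k ^+ 2 * nsq u1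
      - 2 * k * Re (u0^c * z1 * u1).
    by case: u0 u1 z1 => [? ?] [? ?] [? ?]; rewrite /nsq /=; ring.
  have expand2 (a1 a2 u0 u1 : C) : nsq (a1 * u0 + a2 * u1) = nsq a1 * nsq u0 + nsq a2 * nsq u1
      + 2 * Re (u0^c * (a2 * a1^c) * u1).
    by case: u0 u1 a1 a2 => [? ?] [? ?] [? ?] [? ?]; rewrite /nsq /=; ring.
  rewrite expand expand2 !nsqM nsq_conj cE /S; field.
  by rewrite -/S.
have [ad|da] := leP (nsq a) (nsq d).
  apply: (limit (2 * nsq d / S) m ((nsq a - nsq d) ^+ 2 / (2 * S))).
  - rewrite ler_pdivlMr // ler_pdivrMr // /S; have := nsq_ge0 a; have := nsq_ge0 d.
    by move=> *; apply/andP; split; lra.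
  - by rewrite divr_ge0 ?sqr_ge0 // mulr_ge0 // ltW.
  - move=> u; rewrite /P e2E A0 Am nsqM nsq0; have := defect u.
    have -> : (nsq a - nsq d) ^+ 2 / (2 * S) = S / 2 - 2 * nsq d * nsq a / S.
      by rewrite /S; field; rewrite -/S.
    by lra.
have a0 : 0 < nsq a by apply: le_lt_trans da; apply: nsq_ge0.
pose e1 : 'rV[C]_3 := delta_mx 0 o1.
have e1E (u : 'cV[C]_3) : (e1 *m u) 0 0 = u o1 0 by rewrite -rowE !mxE.
apply: (limit (S / (2 * nsq a)) e1 ((nsq a - nsq d) ^+ 2 / (2 * nsq a * S))).
- have p2 : 0 < 2 * nsq a by rewrite mulr_gt0.
  rewrite ler_pdivlMr // ler_pdivrMr // /S; have := nsq_ge0 d.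
  by move=> *; apply/andP; split; lra.
- by rewrite divr_ge0 ?sqr_ge0 // !mulr_ge0 ?nsq_ge0 // ltW.
- move=> u; rewrite /P e2E e1E A0 Am nsqM nsq0; have := defect u.
  have -> : (nsq a - nsq d) ^+ 2 / (2 * nsq a * S) = S / (2 * nsq a) - 2 * nsq d / S.
    by rewrite /S; field; rewrite -/S Sn0 gt_eqF.
  have -> : S / (2 * nsq a) * (nsq a * nsq ((m *m u) 0 0)) = S / 2 * nsq ((m *m u) 0 0).
    by field; rewrite gt_eqF.
  by lra.
Qed.

End Disc.

(** * Tridiagonal matrices *)

Section Tridiagonal.
Context {R : realType}.
Local Notation C := R[i].
Local Notation "z ^c" := (conjc z) (at level 1, format "z ^c").
Local Notation Re := (@complex.Re _).
Local Notation Im := (@complex.Im _).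

Lemma model_crouzeix (r c s : R) : 1 <= r -> c ^+ 2 + s ^+ 2 = 1 -> s ^+ 2 <= c ^+ 2 ->
  crouzeix_sq (model r c s).
Proof.
move=> r1 cs sc; have [r2|/ltW r2] := leP (r ^+ 2) 2; first exact: model_symmetrizable.
by apply: model_crouzeix_large => //; lra.
Qed.

Definition hollow (u1 u2 v1 v2 : C) : 'M[C]_3 := mx3 0 u1 u2 v1 0 0 v2 0 0.

Lemma hollow_tr u1 u2 v1 v2 : (hollow u1 u2 v1 v2)^T = hollow v1 v2 u1 u2.
Proof. by apply/matrixP => i j; elim/forall3: i; elim/forall3: j; rewrite !mxE. Qed.

Lemma hollowZ a u1 u2 v1 v2 :
  hollow (a * u1) (a * u2) (a * v1) (a * v2) = 0%:M + a *: hollow u1 u2 v1 v2.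
Proof.
apply/matrixP => i j; elim/forall3: i; elim/forall3: j; rewrite !mxE /= ?mulr0 ?mulr0n;
by rewrite ?mulr1n ?addr0 ?add0r.
Qed.

Lemma hollow_unitary (p q r s u1 u2 v1 v2 : C) :
  p * p^c + q * q^c = 1 -> r * r^c + s * s^c = 1 -> p * r^c + q * s^c = 0 ->
  crouzeix_sq (hollow (u1 * p^c + u2 * q^c) (u1 * r^c + u2 * s^c) (p * v1 + q * v2) (r * v1 + s * v2)) ->
  crouzeix_sq (hollow u1 u2 v1 v2).
Proof.
move=> pq rs ort; have ort' : r * p^c + s * q^c = 0.
  have -> : r * p^c + s * q^c = (p * r^c + q * s^c)^c by rewrite conjcD !conjcM !conjcK; ring.
  by rewrite ort conjc0.
pose U := mx3 1 0 0 0 p q 0 r s.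
have UU' : U *m adjmx U = 1%:M.
  rewrite mx3_adj mx3_mul mx3_scalar ?conjc0 ?conjc1.
  by congr mx3; rewrite ?mulr0 ?mul0r ?mulr1 ?add0r ?addr0.
have UU : adjmx U *m U = 1%:M by apply: mulmx1C.
have : adjmx U *m U = 1%:M by []; rewrite {1}mx3_adj mx3_mul mx3_scalar => /matrixP UE.
have := UE o1 o1; have := UE o1 o2; have := UE o2 o1; have := UE o2 o2.
rewrite !mxE /= ?conjc0 ?mul0r ?mulr0 ?add0r => e22 e21 e12 e11.
apply: (crouzeix_sq_unitary _ _ _ UU).
rewrite !mx3_mul; congr mx3; rewrite ?mulr0 ?mul0r ?mulr1 ?mul1r ?add0r ?addr0 //.
- transitivity (u1 * (p^c * p + r^c * r) + u2 * (q^c * p + s^c * r)); last by ring.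
  by rewrite e11 e21; ring.
- transitivity (u1 * (p^c * q + r^c * s) + u2 * (q^c * q + s^c * s)); last by ring.
  by rewrite e12 e22; ring.
Qed.

Lemma joukowski_sum (S : R) : 2 <= S -> exists2 rho : R, 1 <= rho & rho + rho^-1 = S.
Proof.
move=> S2; pose rt := Num.sqrt (S ^+ 2 - 4).
have S4 : 0 <= S ^+ 2 - 4 by have : 2 * 2 <= S * S by [rewrite ler_pM]; rewrite expr2; lra.
have rt2 : rt ^+ 2 = S ^+ 2 - 4 by rewrite sqr_sqrtr.
have rt0 : 0 <= rt by apply: sqrtr_ge0.
exists ((S + rt) / 2); first by lra.
have e : (S + rt) / 2 * ((S - rt) / 2) = 1.
  by transitivity ((S ^+ 2 - rt ^+ 2) / 4); [field|rewrite rt2; field].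
have n0 : (S + rt) / 2 != 0 by rewrite gt_eqF //; lra.
have -> : ((S + rt) / 2)^-1 = (S - rt) / 2 by apply: (mulfI n0); rewrite e divff.
by field.
Qed.

Lemma hollow_real_crouzeix (n nu : R) : 0 < n -> 0 <= nu -> n ^- 2 + nu ^+ 2 <= n ^+ 2 ->
  crouzeix_sq (hollow n%:C 0 (n^-1)%:C nu%:C).
Proof.
move=> n0 nu0 nnu; have nn0 : n != 0 by rewrite gt_eqF.
pose N := n ^+ 2; have N0 : 0 < N by rewrite exprn_gt0.
pose S := N + N^-1 + nu ^+ 2.
have nVn : N * N^-1 = 1 by rewrite divff // gt_eqF.
have S2 : 2 <= S.
  have : 0 <= (n - n^-1) ^+ 2 by apply: sqr_ge0.
  have -> : (n - n^-1) ^+ 2 = N + N^-1 - 2 by rewrite /N; field.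
  by have := sqr_ge0 nu; rewrite /S; lra.
have [rho rho1 rhoS] := joukowski_sum S S2.
have rho0 : 0 < rho by lra.
have rr : rho * rho^-1 = 1 by rewrite divff // gt_eqF.
have rV0 : 0 < rho^-1 by rewrite invr_gt0.
suff [c [s [cs sc N_E nu_E]]] : exists c s : R, [/\ c ^+ 2 + s ^+ 2 = 1, s ^+ 2 <= c ^+ 2,
    N = rho * c ^+ 2 + rho^-1 * s ^+ 2 & n * nu = s * c * (rho - rho^-1)].
  pose r := Num.sqrt rho.
  have r2 : r ^+ 2 = rho by rewrite sqr_sqrtr // ltW.
  have r0 : 0 < r by rewrite sqrtr_gt0.
  have rn0 : r != 0 by rewrite gt_eqF.
  have r1 : 1 <= r by rewrite -(@ler_sqr _ 1 r) ?nnegrE ?ler01 ?(ltW r0) // expr1n r2.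
  have N_E' : n ^+ 2 = r ^+ 2 * c ^+ 2 + r ^- 2 * s ^+ 2 by rewrite r2 -N_E.
  have nu_E' : nu = s * c * (r ^+ 2 - r ^- 2) / n by rewrite r2 -nu_E mulrAC divff ?mul1r.
  have := model_crouzeix r c s r1 cs sc; rewrite /model -/(hollow _ _ _ _).
  pose p := r * c / n; pose q := - (s / (r * n)).
  have pq : p * p + q * q = 1.
    by transitivity ((r ^+ 2 * c ^+ 2 + r ^- 2 * s ^+ 2) / n ^+ 2);
      [rewrite /p /q; field; apply/andP|rewrite -N_E' divff ?expf_neq0].
  have e3 : p * n^-1 + q * nu = c / r.
    transitivity (c / r * (r ^+ 2 * (c ^+ 2 + s ^+ 2 - s ^+ 2) + r ^- 2 * s ^+ 2) / n ^+ 2).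
      by rewrite cs nu_E' /p /q; field; apply/andP.
    by rewrite addrK -N_E' mulfK // expf_neq0.
  have e4 : - q * n^-1 + p * nu = r * s.
    transitivity (r * s * (r ^- 2 * (1 - c ^+ 2) + r ^+ 2 * c ^+ 2) / n ^+ 2).
      by rewrite nu_E' /p /q; field; apply/andP.
    by rewrite -cs (addrC (c ^+ 2)) addrK addrC -N_E' mulfK // expf_neq0.
  have e1 : n * p = r * c by rewrite /p mulrCA divff // mulr1.
  have e2 : n * - q = s / r by rewrite /q opprK; field; apply/andP.
  rewrite -e1 -e2 -e3 -e4 => cr; apply: (@hollow_unitary p%:C q%:C (- q)%:C p%:C).
  - by rewrite !conjc_real -!rmorphM -rmorphD pq.
  - by rewrite !conjc_real -!rmorphM -rmorphD mulrNN addrC pq.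
  - by rewrite !conjc_real -!rmorphM -rmorphD /= mulrN mulrC addNr.
  - by rewrite !conjc_real !mul0r !addr0 -!rmorphM -!rmorphD.
have prodE : (N - rho) * (N - rho^-1) = - (N * nu ^+ 2).
  transitivity (N * (N + N^-1 - (rho + rho^-1)) + (1 - N * N^-1) + (rho * rho^-1 - 1)); first by ring.
  by rewrite nVn rr rhoS /S; ring.
have [rho_eq|rho_neq] := eqVneq rho 1.
  move: prodE; rewrite rho_eq invr1 => prodE.
  have h : 0 <= (N - 1) * (N - 1) by rewrite -expr2 sqr_ge0.
  have Nnu : N * nu ^+ 2 = 0.
    have : 0 <= N * nu ^+ 2 by rewrite mulr_ge0 ?sqr_ge0 // ltW.
    by rewrite prodE in h; lra.
  have nu_0 : nu = 0 by move/eqP: Nnu; rewrite mulf_eq0 gt_eqF //= sqrf_eq0 => /eqP.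
  have N1 : N = 1.
    by move: prodE; rewrite Nnu oppr0 -expr2 => /eqP; rewrite sqrf_eq0 subr_eq0 => /eqP.
  by exists 1, 0; rewrite N1 nu_0; split; [ring|rewrite expr0n expr1n|ring|ring].
have rho_gt1 : 1 < rho by rewrite lt_neqAle eq_sym rho_neq.
have rV1 : rho^-1 < 1 by rewrite invf_lt1.
pose dl := rho - rho^-1; have dl0 : 0 < dl by rewrite /dl; lra.
have dn0 : dl != 0 by rewrite gt_eqF.
have prod_le : 0 <= (rho - N) * (N - rho^-1).
  by rewrite -opprB mulNr prodE opprK mulr_ge0 ?sqr_ge0 // ltW.
have NS : S <= 2 * N by have : N^-1 + nu ^+ 2 <= N by []; rewrite /S; lra.
have N_ge : 0 <= N - rho^-1 by rewrite -rhoS in NS; lra.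
have N_le : 0 <= rho - N.
  rewrite leNgt; apply/negP => NN; have N_gt : 0 < N - rho^-1 by rewrite -rhoS in NS; lra.
  by have := mulr_gt0 (_ : 0 < N - rho) N_gt; rewrite -opprB mulNr in prod_le *; lra.
pose c := Num.sqrt ((N - rho^-1) / dl); pose s := Num.sqrt ((rho - N) / dl).
have c2 : c ^+ 2 = (N - rho^-1) / dl by rewrite sqr_sqrtr // divr_ge0 // ltW.
have s2 : s ^+ 2 = (rho - N) / dl by rewrite sqr_sqrtr // divr_ge0 // ltW.
exists c, s; split.
- by rewrite c2 s2 -mulrDl /dl addrC addrA subrK divff.
- by rewrite c2 s2 ler_pM2r ?invr_gt0 // -rhoS in NS *; lra.
- rewrite c2 s2; transitivity (N * (rho - rho^-1) / dl); first by rewrite mulfK.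
  by ring.
- apply/eqP; rewrite -(@eqrXn2 _ 2) // ?mulr_ge0 ?sqrtr_ge0 // ?(ltW n0) ?(ltW dl0) //.
  rewrite !exprMn c2 s2 -/N -/dl; apply/eqP.
  have -> : N * nu ^+ 2 = (rho - N) * (N - rho^-1).
    by rewrite -[RHS]opprK -mulNr opprB prodE opprK.
  by field; rewrite dn0 gt_eqF.
Qed.

Lemma unit_phase (z : C) : exists e : C, e * e^c = 1 /\ e * z = (cmod z)%:C.
Proof.
have [->|z0] := eqVneq z 0.
  by exists 1; rewrite conjc1 !mulr1 mulr0 /cmod Normc.normc0.
have c0 : cmod z != 0 by apply: contra z0 => /eqP/Normc.eq0_normc ->.
have cC : (cmod z)%:C != 0 :> C by rewrite eq_complex /= negb_and c0.
have zz : z * z^c = (cmod z)%:C ^+ 2 by rewrite -nsqC -cmod_sqr rmorphXn.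
exists (z^c / (cmod z)%:C); split.
  rewrite conjcM conjc_inv conjcK conjc_real.
  by transitivity (z * z^c / (cmod z)%:C ^+ 2); [field|rewrite zz divff ?expf_neq0].
by rewrite mulrAC [z^c * z]mulrC zz expr2 mulfK.
Qed.

Lemma rotation_to_axis (u1 u2 : C) (n : R) : 0 < n -> n ^+ 2 = nsq u1 + nsq u2 ->
  let p := u1 / n%:C in let q := u2 / n%:C in
  [/\ p * p^c + q * q^c = 1, u1 * p^c + u2 * q^c = n%:C & - u1 * q + u2 * p = 0].
Proof.
move=> n0 nE p q; have nC : n%:C != 0 :> C by rewrite eq_complex /= gt_eqF.
have nE' : u1 * u1^c + u2 * u2^c = n%:C ^+ 2 by rewrite -!nsqC -rmorphD -nE rmorphXn.
rewrite /p /q !(conjcM, conjc_inv) !conjc_real; split.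
- by transitivity ((u1 * u1^c + u2 * u2^c) / n%:C ^+ 2); [field|rewrite nE' divff ?expf_neq0].
- by transitivity ((u1 * u1^c + u2 * u2^c) / n%:C); [field|rewrite nE' expr2 mulfK].
- by ring.
Qed.

Lemma hollow_unit_crouzeix (u1 u2 v1 v2 : C) : u1 * v1 + u2 * v2 = 1 ->
  nsq v1 + nsq v2 <= nsq u1 + nsq u2 -> crouzeix_sq (hollow u1 u2 v1 v2).
Proof.
move=> uv vu; pose n := Num.sqrt (nsq u1 + nsq u2).
have n2 : n ^+ 2 = nsq u1 + nsq u2 by rewrite sqr_sqrtr // addr_ge0 ?nsq_ge0.
have u0 : 0 < nsq u1 + nsq u2.
  rewrite lt_neqAle addr_ge0 ?nsq_ge0 // andbT eq_sym paddr_eq0 ?nsq_ge0 //.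
  apply/negP => /andP[/eqP/nsq_eq0 u10 /eqP/nsq_eq0 u20]; move: uv.
  by rewrite u10 u20 !mul0r addr0 => /esym/eqP; rewrite oner_eq0.
have n0 : 0 < n by rewrite sqrtr_gt0.
have nC : n%:C != 0 :> C by rewrite eq_complex /= gt_eqF.
have [pq up uq] := rotation_to_axis u1 u2 n n0 n2.
set p := u1 / n%:C in pq up uq; set q := u2 / n%:C in pq up uq.
have [e [ee eE]] := unit_phase (- q^c * v1 + p^c * v2); set nu := cmod _ in eE.
have pqc : p^c * p + q^c * q = 1 by rewrite -pq; ring.
have v1E : p * v1 + q * v2 = (n^-1)%:C.
  by rewrite fmorphV /= -[RHS]mulr1 -uv /p /q; field.
clearbody p q.
apply: (@hollow_unitary p q (- e * q^c) (e * p^c)) => //.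
- rewrite !conjcM !conjcK ?conjcN.
  by transitivity (e * e^c * (p * p^c + q * q^c)); [ring|rewrite ee pq mulr1].
- by rewrite !conjcM !conjcK ?conjcN; ring.
have -> : u1 * p^c + u2 * q^c = n%:C by [].
have -> : u1 * (- e * q^c)^c + u2 * (e * p^c)^c = 0.
  rewrite !conjcM !conjcK ?conjcN.
  by transitivity (e^c * (- u1 * q + u2 * p)); [ring|rewrite uq mulr0].
have -> : - e * q^c * v1 + e * p^c * v2 = nu%:C by rewrite -eE; ring.
rewrite v1E; apply: hollow_real_crouzeix => //; first exact: cmod_ge0.
rewrite cmod_sqr [leRHS]n2; apply: le_trans vu; rewrite le_eqVlt; apply/orP; left; apply/eqP.
apply: (@complexI R); have -> : n ^- 2 = nsq (p * v1 + q * v2).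
  by rewrite v1E nsq_real exprVn.
have nsq2C (x y : C) : (nsq x + nsq y)%:C = x * x^c + y * y^c.
  by rewrite -!nsqC; apply: rmorphD.
rewrite !nsq2C !(conjcD, conjcM) conjcN !conjcK.
transitivity ((p * p^c + q * q^c) * (v1 * v1^c + v2 * v2^c)); first by ring.
by rewrite pq mul1r.
Qed.

Definition swap01 : 'M[C]_3 := mx3 0 1 0 1 0 0 0 0 1.

Lemma swap01_unitary : adjmx swap01 *m swap01 = 1%:M.
Proof.
rewrite mx3_adj mx3_mul mx3_scalar !conjc0 !conjc1.
by congr mx3; rewrite ?mulr0 ?mul0r ?mulr1 ?add0r ?addr0.
Qed.

Lemma hollow_nilpotent_crouzeix (a d : C) : 0 < nsq a + nsq d ->
  crouzeix_sq (hollow a 0 0 d).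
Proof.
move=> ad; pose k := Num.sqrt ((nsq a + nsq d) / 4).
have k2 : k ^+ 2 = (nsq a + nsq d) / 4 by rewrite sqr_sqrtr // divr_ge0 // ltW.
have k0 : 0 < k by rewrite sqrtr_gt0 divr_gt0.
have kn0 : k != 0 by rewrite gt_eqF.
have kC : k%:C != 0 :> C by rewrite eq_complex /= gt_eqF.
have -> : hollow a 0 0 d = 0%:M + k%:C *: hollow (a / k%:C) 0 0 (d / k%:C).
  by rewrite -hollowZ !mulr0 !mulrA ![k%:C * _]mulrC !mulfK.
apply: crouzeix_sq_affine; move: (a / k%:C) (d / k%:C) (mulfVK kC a) (mulfVK kC d).
move=> a' d' aE dE; have ad4 : nsq a' + nsq d' = 4.
  apply: (mulIf (expf_neq0 2 kn0)); rewrite mulrDl -!nsq_real -!nsqM aE dE nsq_real k2.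
  by field.
have := disc_crouzeix a' 0 d' 0; rewrite nsq0 addr0 ad4 mul0r conjc0 mulr0 oppr0.
move=> /(_ erefl erefl) disc; apply: (crouzeix_sq_unitary _ _ _ swap01_unitary _ (disc _)).
  by rewrite /disc_model !mx3_mul; congr mx3; ring.
move=> w ww; have [h h2] : exists h : R, h ^+ 2 = 1 / 8.
  by exists (Num.sqrt (1 / 8)); rewrite sqr_sqrtr // divr_ge0.
have nw : nsq w = 1 by apply: (@complexI R); rewrite nsqC ww.
have w0 : w != 0 by apply/eqP => w0; move: ww; rewrite w0 mul0r => /eqP; rewrite eq_sym oner_eq0.
pose x := cv3 (h%:C * (a'^c * w)) (2 * h%:C) (h%:C * (d' * w^c)).
have x1 : N2 x = 1.
  have n2 : nsq (2 : C) = 4 by rewrite (_ : 2 = 2%:R%:C) ?nsq_real ?rmorph_nat //; ring.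
  rewrite N2_3 !cv3E !nsqM !nsq_conj nw !nsq_real h2 n2.
  by transitivity (1 / 8 * (nsq a' + nsq d' + 4)); [field|rewrite ad4; field].
have := numerical_range3 (disc_model a' 0 d' 0) x x1.
rewrite mx3_mulv !cv3E !conjcM !conjcK !conjc_real; congr numerical_range.
have c2 : (2 : C)^c = 2 by apply: (conjc_nat _ 2).
have hC : (h%:C * h%:C : C) = 1 / 8 by rewrite -rmorphM -expr2 h2 fmorph_div rmorph_nat rmorph1.
transitivity (2 * (h%:C * h%:C) * w * (a' * a'^c + d' * d'^c)); first by rewrite c2; ring.
by rewrite hC -!nsqC -rmorphD ad4 rmorph_nat; field.
Qed.

Lemma scalar_crouzeix (a : C) : crouzeix_sq (a%:M : 'M[C]_3).
Proof.
have -> : (a%:M : 'M[C]_3) = a%:M + 0 *: model 1 1 0 by rewrite scale0r addr0.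
apply: crouzeix_sq_affine; apply: model_crouzeix; rewrite ?expr0n ?expr1n ?addr0 //.
Qed.

Lemma hollow_crouzeix (u1 u2 v1 v2 : C) : crouzeix_sq (hollow u1 u2 v1 v2).
Proof.
wlog vu : u1 u2 v1 v2 / nsq v1 + nsq v2 <= nsq u1 + nsq u2.
  move=> H; have [|/ltW] := leP (nsq v1 + nsq v2) (nsq u1 + nsq u2); first exact: H.
  by move=> uv; apply: crouzeix_sq_tr; rewrite hollow_tr; apply: H.
have [uv0|uv_neq0] := eqVneq (u1 * v1 + u2 * v2) 0; last first.
  pose s := sqrtc (u1 * v1 + u2 * v2).
  have s2 : s ^+ 2 = u1 * v1 + u2 * v2 by apply: sqr_sqrtc.
  have s0 : s != 0 by rewrite sqrtc_eq0.
  have -> : hollow u1 u2 v1 v2 = 0%:M + s *: hollow (u1 / s) (u2 / s) (v1 / s) (v2 / s).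
    by rewrite -hollowZ ![s * _]mulrC !mulfVK.
  apply: crouzeix_sq_affine; apply: hollow_unit_crouzeix.
    by transitivity ((u1 * v1 + u2 * v2) / s ^+ 2); [field|rewrite -s2 divff ?expf_neq0].
  by rewrite !nsqM -!mulrDl ler_wpM2r ?nsq_ge0.
have u_ge0 : 0 <= nsq u1 + nsq u2 by rewrite addr_ge0 ?nsq_ge0.
move: (u_ge0); rewrite le_eqVlt => /orP[/eqP/esym u0|u0].
  have v0 : nsq v1 + nsq v2 = 0.
    by apply/eqP; rewrite eq_le addr_ge0 ?nsq_ge0 // andbT -u0.
  move/eqP: u0; rewrite paddr_eq0 ?nsq_ge0 // => /andP[/eqP/nsq_eq0 -> /eqP/nsq_eq0 ->].
  move/eqP: v0; rewrite paddr_eq0 ?nsq_ge0 // => /andP[/eqP/nsq_eq0 -> /eqP/nsq_eq0 ->].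
  have -> : hollow 0 0 0 0 = 0%:M by rewrite mx3_scalar.
  exact: scalar_crouzeix.
pose n := Num.sqrt (nsq u1 + nsq u2).
have n2 : n ^+ 2 = nsq u1 + nsq u2 by rewrite sqr_sqrtr.
have n0 : 0 < n by rewrite sqrtr_gt0.
have nC : n%:C != 0 :> C by rewrite eq_complex /= gt_eqF.
have [pq up uq] := rotation_to_axis u1 u2 n n0 n2.
set p := u1 / n%:C in pq up uq; set q := u2 / n%:C in pq up uq.
have pv : p * v1 + q * v2 = 0.
  by transitivity ((u1 * v1 + u2 * v2) / n%:C); [rewrite /p /q; field|rewrite uv0 mul0r].
clearbody p q; apply: (@hollow_unitary p q (- q^c) p^c) => //.
- by rewrite !conjcN !conjcK -pq; ring.
- by rewrite !conjcN !conjcK; ring.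
rewrite !conjcN !conjcK up.
have -> : u1 * - q + u2 * p = 0 by rewrite -uq; ring.
rewrite pv; apply: hollow_nilpotent_crouzeix; rewrite nsq_real ltr_wpDr ?nsq_ge0 // exprn_gt0 //.
Qed.

Lemma tridiag_crouzeix (a b1 b2 c1 c2 : C) : crouzeix_sq (tridiag3 a b1 b2 c1 c2).
Proof.
have -> : tridiag3 a b1 b2 c1 c2 = a%:M + 1 *: mx3 0 b1 0 c1 0 b2 0 c2 0.
  apply/matrixP => i j; elim/forall3: i; elim/forall3: j; rewrite !mxE /=;
  by rewrite mul1r ?mulr1n ?mulr0n ?addr0 ?add0r.
apply: crouzeix_sq_affine; apply: (crouzeix_sq_unitary _ _ _ swap01_unitary _ (hollow_crouzeix c1 b2 b1 c2)).
by rewrite !mx3_mul; congr mx3; ring.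
Qed.

End Tridiagonal.

(** * Elliptic numerical ranges *)

Section Kippenhahn.
Context {R : realType}.
Local Notation C := R[i].
Local Notation "z ^c" := (conjc z) (at level 1, format "z ^c").
Local Notation Re := (@complex.Re _).
Local Notation Im := (@complex.Im _).

Definition minor2 (M : 'M[C]_3) i j := M i i * M j j - M i j * M j i.

Definition det3 (M : 'M[C]_3) :=
  M o0 o0 * (M o1 o1 * M o2 o2 - M o1 o2 * M o2 o1)
  - M o0 o1 * (M o1 o0 * M o2 o2 - M o1 o2 * M o2 o0)
  + M o0 o2 * (M o1 o0 * M o2 o1 - M o1 o1 * M o2 o0).

Definition minors3 (M : 'M[C]_3) := minor2 M o0 o1 + minor2 M o0 o2 + minor2 M o1 o2.

Definition trace3 (M : 'M[C]_3) := M o0 o0 + M o1 o1 + M o2 o2.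

Lemma det2E (B : 'M[C]_2) :
  \det B = B ord0 ord0 * B ord_max ord_max - B ord0 ord_max * B ord_max ord0.
Proof.
rewrite (expand_det_row _ ord0) !big_ord_recl big_ord0 /cofactor !det_mx11 !mxE /=.
rewrite !expr0 expr1 addr0 mul1r mulN1r mulrN.
by congr (B _ _ * B _ _ - B _ _ * B _ _); apply: val_inj.
Qed.

Lemma det3E (M : 'M[C]_3) : \det M = det3 M.
Proof.
rewrite [in LHS](mx3_eta M) (expand_det_row _ ord0) !big_ord_recl big_ord0 /cofactor.
by rewrite !det2E !mxE /= /det3 /bump /=; ring.
Qed.

Lemma char3 (M : 'M[C]_3) k :
  \det (M - k%:M) = - k ^+ 3 + trace3 M * k ^+ 2 - minors3 M * k + det3 M.
Proof.
rewrite det3E /det3 /minors3 /minor2 /trace3 !mxE /= !mulr1n !mulr0n; ring.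
Qed.

Lemma ker_det (M : 'M[C]_3) (v : 'cV[C]_3) : v != 0 -> M *m v = 0 -> \det M = 0.
Proof.
move=> v0 Mv; rewrite -det_tr; apply/eqP/det0P; exists v^T.
  by rewrite trmx_eq0.
by rewrite -trmx_mul Mv trmx0.
Qed.

Lemma psd_zero (K : 'M[C]_3) (x : 'cV[C]_3) : adjmx K = K ->
  (forall y : 'cV[C]_3, 0 <= Re ((adjmx y *m K *m y) 0 0)) ->
  Re ((adjmx x *m K *m x) 0 0) = 0 -> K *m x = 0.
Proof.
move=> KK psd qx; apply: N2_eq0; set y := K *m x.
have adjD (u v : 'cV[C]_3) : adjmx (u + v) = adjmx u + adjmx v.
  by apply/matrixP => i j; rewrite !mxE conjcD.
have adjZ (t : R) (u : 'cV[C]_3) : adjmx (t%:C *: u) = t%:C *: adjmx u.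
  by apply/matrixP => i j; rewrite !mxE conjcM conjc_real.
have xK : adjmx x *m K = adjmx y by rewrite adjmxM KK.
pose q := Re ((adjmx y *m K *m y) 0 0).
have quad t : Re ((adjmx (x + t%:C *: y) *m K *m (x + t%:C *: y)) 0 0) = 2 * t * N2 y + t ^+ 2 * q.
  have -> : (adjmx (x + t%:C *: y) *m K *m (x + t%:C *: y)) 0 0 =
      (adjmx x *m K *m x) 0 0 + t%:C * (adjmx y *m y) 0 0 + t%:C * (adjmx y *m y) 0 0
      + t%:C * t%:C * (adjmx y *m K *m y) 0 0.
    rewrite adjD adjZ !mulmxDl !mulmxDr -!scalemxAl -!scalemxAr xK.
    rewrite -[adjmx y *m K *m x]mulmxA -/y !mxE; ring.
  rewrite N2_adj; move: qx; rewrite /q; move: (_ 0 0) ((adjmx y *m K *m y) 0 0) => [a b] [e f] /= ->.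
  by ring.
have q0 : 0 <= q by apply: psd.
have N0 := N2_ge0 y; apply/eqP; rewrite eq_le N0 andbT leNgt; apply/negP => Ny.
have q1 : 0 < q + 1 by lra.
have := psd (x + (- (N2 y / (q + 1)))%:C *: y); rewrite quad.
have -> : 2 * - (N2 y / (q + 1)) * N2 y + (- (N2 y / (q + 1))) ^+ 2 * q =
   - (N2 y ^+ 2 / (q + 1)) * (1 + (q + 1)^-1) by field; rewrite gt_eqF.
rewrite mulNr oppr_ge0 leNgt mulr_gt0 // ?divr_gt0 ?exprn_gt0 //.
by rewrite addr_gt0 ?invr_gt0.
Qed.

Lemma ellipse_support_le (sg w z : C) (L : R) : z * z^c = 1 ->
  cmod (w - sg) + cmod (w + sg) <= L ->
  Re (z * w) ^+ 2 <= L ^+ 2 / 4 - nsq sg + Re (z * sg) ^+ 2.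
Proof.
move=> zz; have nz : nsq z = 1 by apply: (@complexI R); rewrite nsqC zz.
have cz u : cmod (z * u) = cmod u.
  rewrite /cmod Normc.normcM -/(cmod z) (_ : cmod z = 1) ?mul1r //.
  by apply/eqP; rewrite -(@pexpr_eq1 _ _ 2) ?cmod_ge0 // cmod_sqr nz.
rewrite -(cz (w - sg)) -(cz (w + sg)) mulrBr mulrDr (_ : nsq sg = nsq (z * sg)); last by rewrite nsqM nz mul1r.
move: (z * w) (z * sg) => [x y] [s t] leL.
have tri : cmod (2 * x +i* (2 * - t)) <= L.
  apply: le_trans leL.
  have -> : cmod (x +i* y + (s +i* t)) = cmod ((x + s) +i* - (y + t)).
    by rewrite /cmod /= sqrrN.
  have -> : 2 * x +i* (2 * - t) = (x +i* y - (s +i* t)) + ((x + s) +i* - (y + t)).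
    by apply/eqP; rewrite eq_complex /=; apply/andP; split; apply/eqP; ring.
  exact: le_normcD.
have : cmod (2 * x +i* (2 * - t)) ^+ 2 <= L ^+ 2.
  by rewrite ler_sqr ?nnegrE ?cmod_ge0 // (le_trans (cmod_ge0 _) tri).
rewrite cmod_sqr /nsq /=.
have -> : (2 * x) ^+ 2 + (2 * - t) ^+ 2 = 4 * (x ^+ 2 + t ^+ 2) by ring.
by lra.
Qed.

Lemma ellipse_support_attained (sg z : C) (L : R) : z * z^c = 1 -> 2 * cmod sg <= L ->
  exists w, cmod (w - sg) + cmod (w + sg) <= L /\
    Re (z * w) = Num.sqrt (L ^+ 2 / 4 - nsq sg + Re (z * sg) ^+ 2).
Proof.
move=> zz sL; have nz : nsq z = 1 by apply: (@complexI R); rewrite nsqC zz.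
have cz u : cmod (z^c * u) = cmod u.
  rewrite /cmod Normc.normcM -/(cmod z^c) (_ : cmod z^c = 1) ?mul1r //.
  by apply/eqP; rewrite -(@pexpr_eq1 _ _ 2) ?cmod_ge0 // cmod_sqr nsq_conj nz.
have sg2 : nsq sg <= L ^+ 2 / 4.
  have : (2 * cmod sg) ^+ 2 <= L ^+ 2.
    by rewrite ler_sqr ?nnegrE ?(le_trans _ sL) // mulr_ge0 ?cmod_ge0.
  by rewrite exprMn cmod_sqr; lra.
have L0 : 0 <= L by apply: le_trans sL; rewrite mulr_ge0 ?cmod_ge0.
have sgE : sg = z^c * (z * sg) by rewrite mulrA [_ * z]mulrC zz mul1r.
have sgN : nsq (z * sg) = nsq sg by rewrite nsqM nz mul1r.
rewrite -sgN in sg2 *; move: sgE; move: (z * sg) sg2 => [s t] sg2 sgE.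
set H := L ^+ 2 / 4 - _ + _; have HE : H = L ^+ 2 / 4 - t ^+ 2 by rewrite /H /nsq /=; ring.
have Hs : s ^+ 2 <= H by rewrite HE; move: sg2; rewrite /nsq /=; lra.
have H0 : 0 <= H by apply: le_trans Hs; apply: sqr_ge0.
pose h := Num.sqrt H; have h2 : h ^+ 2 = H by rewrite sqr_sqrtr.
have h0 : 0 <= h by apply: sqrtr_ge0.
have [hz|hn0] := eqVneq h 0.
  exists 0; rewrite mulr0 -/h hz; split=> //; apply: le_trans sL.
  rewrite sub0r add0r (_ : cmod (- sg) = cmod sg); first by rewrite mulr2n mulrDl mul1r.
  by rewrite /cmod normcN.
have sh : `|s| <= h by rewrite -ler_sqr ?nnegrE // real_normK ?num_real // h2.
move: sh; rewrite ler_norml => /andP[sh1 sh2].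
have Lh : L ^+ 2 = 4 * (h ^+ 2 + t ^+ 2) by rewrite h2 HE; field.
have cmodE (e : R) : (e = 1 \/ e = -1) -> cmod ((h - e * s) +i* (s * t / h - e * t)) = (h - e * s) * L / (2 * h).
  move=> e1; have e2 : e ^+ 2 = 1 by case: e1 => ->; rewrite ?sqrrN expr1n.
  have hs : 0 <= h - e * s by case: e1 => ->; lra.
  apply/eqP; rewrite -(@eqrXn2 _ 2) // ?cmod_ge0 ?divr_ge0 ?mulr_ge0 //.
  rewrite cmod_sqr /nsq /= exprMn exprVn exprMn Lh; apply/eqP.
  transitivity ((h - e * s) ^+ 2 + (s ^+ 2 - 2 * e * s * h + e ^+ 2 * h ^+ 2) * t ^+ 2 / h ^+ 2); first by field.
  transitivity ((h - e * s) ^+ 2 + (e ^+ 2 * s ^+ 2 - 2 * e * s * h + h ^+ 2) * t ^+ 2 / h ^+ 2); last by field.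
  by rewrite e2; field.
exists (z^c * (h +i* (s * t / h))); split; last first.
  by rewrite mulrA zz mul1r.
rewrite {1 2}sgE -mulrBr -mulrDr !cz.
have -> : (h +i* (s * t / h)) - (s +i* t) = (h - 1 * s) +i* (s * t / h - 1 * t).
  by apply/eqP; rewrite eq_complex /= !mul1r !eqxx.
have -> : (h +i* (s * t / h)) + (s +i* t) = (h - -1 * s) +i* (s * t / h - -1 * t).
  by apply/eqP; rewrite eq_complex /= !mulN1r !opprK !eqxx.
rewrite !cmodE; [|by right|by left].
by rewrite le_eqVlt; apply/orP; left; apply/eqP; field.
Qed.

Definition rotated (A : 'M[C]_3) z := z *: A + z^c *: adjmx A.

Definition centred_ellipse (A : 'M[C]_3) (sg : C) (L : R) :=
  2 * cmod sg <= L /\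
  forall w, numerical_range A w <-> cmod (w - sg) + cmod (w + sg) <= L.

Lemma rotated_extremal (A : 'M[C]_3) sg L z (h : R) : centred_ellipse A sg L -> z * z^c = 1 ->
  h ^+ 2 = L ^+ 2 / 4 - nsq sg + Re (z * sg) ^+ 2 -> 0 <= h ->
  \det (rotated A z - (2 * h)%:C%:M) = 0.
Proof.
move=> [sL rangeA] zz hE h0.
have [w [wE wh]] := ellipse_support_attained sg z L zz sL.
rewrite -hE sqrtr_sqr ger0_norm // in wh.
have /numerical_rangeP[x x1 wx] : numerical_range A w by apply/rangeA.
pose K := (2 * h)%:C%:M - rotated A z.
have KE (y : 'cV[C]_3) : Re ((adjmx y *m K *m y) 0 0) =
    2 * h * N2 y - 2 * Re (z * (adjmx y *m A *m y) 0 0).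
  have cE : (adjmx y *m adjmx A *m y) 0 0 = ((adjmx y *m A *m y) 0 0)^c.
    transitivity (adjmx (adjmx y *m A *m y) 0 0); last by rewrite !mxE.
    by rewrite !adjmxM adjmxK mulmxA.
  rewrite /K /rotated mulmxBr mulmxBl mulmxDr mulmxDl -!scalemxAr -!scalemxAl mul_mx_scalar -scalemxAl.
  have -> (X Y Z : 'M[C]_1) a b k : (k *: X - (a *: Y + b *: Z)) 0 0 = k * X 0 0 - (a * Y 0 0 + b * Z 0 0).
    by rewrite !mxE.
  rewrite cE N2_adj; move: ((adjmx y *m A *m y) 0 0) => [e f]; case: (z) => [e' f'] /=; ring.
have KK : adjmx K = K.
  apply/matrixP => i j; rewrite !mxE conjcD !conjcN !conjcD !conjcM !conjcK.
  by rewrite (rmorphMn (@conjc R)) /= oppr0 eq_sym; congr (_ - _); rewrite addrC.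
have Kx : K *m x = 0.
  apply: psd_zero => // [y|]; last by rewrite KE x1 -wx wh mulr1 subrr.
  rewrite KE -mulrA -mulrBr mulr_ge0 // subr_ge0.
  have [->|y0] := eqVneq y 0; first by rewrite mulmx0 mxE mulr0 /= mulr_ge0 ?N2_ge0.
  have Ny : N2 y != 0 by apply: contra y0 => /eqP/N2_eq0 ->.
  have Ny0 : 0 < N2 y by rewrite lt_neqAle eq_sym Ny N2_ge0.
  pose k := (Num.sqrt (N2 y))^-1.
  have k2 : k ^+ 2 * N2 y = 1 by rewrite exprVn sqr_sqrtr ?mulVf ?N2_ge0.
  have u1 : N2 (k%:C *: y) = 1 by rewrite N2Z nsq_real.
  have u_in : numerical_range A ((adjmx (k%:C *: y) *m A *m (k%:C *: y)) 0 0).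
    by apply/numerical_rangeP; exists (k%:C *: y).
  have := ellipse_support_le sg _ z L zz ((rangeA _).1 u_in); rewrite -hE.
  have -> : (adjmx (k%:C *: y) *m A *m (k%:C *: y)) 0 0 = k%:C * (k%:C * (adjmx y *m A *m y) 0 0).
    have -> : adjmx (k%:C *: y) = k%:C *: adjmx y.
      by apply/matrixP => i j; rewrite !mxE conjcM conjc_real.
    by rewrite -!scalemxAl -scalemxAr !mxE.
  have -> : Re (z * (k%:C * (k%:C * (adjmx y *m A *m y) 0 0))) = k ^+ 2 * Re (z * (adjmx y *m A *m y) 0 0).
    by move: ((adjmx y *m A *m y) 0 0) => [e f]; case: (z) => [e' f'] /=; ring.
  move=> sq; have : k ^+ 2 * Re (z * (adjmx y *m A *m y) 0 0) <= h.
    by apply: le_trans (ler_norm _) _; rewrite -ler_sqr ?nnegrE // real_normK ?num_real.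
  by move=> /(ler_wpM2r (ltW Ny0)); rewrite mulrAC k2 mul1r.
have x0 : x != 0.
  apply/eqP => x0; have : N2 x = 0 by rewrite x0 /N2 big1 // => i _; rewrite mxE nsq0.
  by rewrite x1 => /eqP; rewrite oner_eq0.
by apply: (ker_det _ x) => //; rewrite -opprB mulNmx Kx oppr0.
Qed.

Lemma rotatedE (A : 'M[C]_3) z i j : rotated A z i j = z * A i j + z^c * (A j i)^c.
Proof. by rewrite !mxE. Qed.

Lemma centred_ellipse_bound (A : 'M[C]_3) sg L : centred_ellipse A sg L -> 0 <= L ^+ 2 / 4 - nsq sg.
Proof.
move=> [sL _]; have : (2 * cmod sg) ^+ 2 <= L ^+ 2.
  by rewrite ler_sqr ?nnegrE ?(le_trans _ sL) // mulr_ge0 ?cmod_ge0.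
by rewrite exprMn cmod_sqr; lra.
Qed.

Lemma kippenhahn (A : 'M[C]_3) sg L z (H := L ^+ 2 / 4 - nsq sg + Re (z * sg) ^+ 2) :
  centred_ellipse A sg L -> z * z^c = 1 ->
  det3 (rotated A z) = - ((4 * H)%:C * trace3 (rotated A z)) /\
  (0 < H -> minors3 (rotated A z) = - (4 * H)%:C).
Proof.
move=> EA zz; have H0 : 0 <= H by rewrite addr_ge0 ?sqr_ge0 // (centred_ellipse_bound A).
pose h := Num.sqrt H; have h2 : h ^+ 2 = H by rewrite sqr_sqrtr.
have h0 : 0 <= h by apply: sqrtr_ge0.
have e1 := rotated_extremal A sg L z h EA zz h2 h0.
have e2 : \det (rotated A (- z) - (2 * h)%:C%:M) = 0.
  apply: (rotated_extremal A sg L (- z)) => //; first by rewrite conjcN mulrNN.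
  by rewrite h2 /H mulNr; case: (z * sg) => s t /=; rewrite sqrrN.
have rotN : rotated A (- z) = - rotated A z.
  by apply/matrixP => i j; rewrite [RHS]mxE !rotatedE conjcN !mulNr opprD.
rewrite rotN !char3 in e1 e2; set k := (2 * h)%:C in e1 e2.
have k2 : k ^+ 2 = (4 * H)%:C by rewrite -rmorphXn exprMn h2 -natrX.
have tN : trace3 (- rotated A z) = - trace3 (rotated A z).
  rewrite /trace3; have N i j : (- rotated A z) i j = - rotated A z i j by rewrite mxE.
  by rewrite !N; ring.
have mN : minors3 (- rotated A z) = minors3 (rotated A z).
  rewrite /minors3 /minor2; have N i j : (- rotated A z) i j = - rotated A z i j by rewrite mxE.
  by rewrite !N; ring.
have dN : det3 (- rotated A z) = - det3 (rotated A z).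
  rewrite /det3; have N i j : (- rotated A z) i j = - rotated A z i j by rewrite mxE.
  by rewrite !N; ring.
rewrite {}tN {}mN {}dN in e2; move: e1 e2.
move: (trace3 _) (minors3 _) (det3 _) => t e d e1 e2; split.
  apply: (mulfI (_ : 2 != 0)); first by rewrite pnatr_eq0.
  rewrite -k2; transitivity ((- k ^+ 3 + t * k ^+ 2 - e * k + d) - (- k ^+ 3 + - t * k ^+ 2 - e * k + - d)
     - 2 * (k ^+ 2 * t)); first by ring.
  by rewrite e1 e2; ring.
move=> H_gt0; have k0 : k != 0 by rewrite eq_complex /= gt_eqF // mulr_gt0 // sqrtr_gt0.
apply: (mulfI k0); rewrite -k2; apply: (mulfI (_ : 2 != 0)); first by rewrite pnatr_eq0.
transitivity (- (- k ^+ 3 + t * k ^+ 2 - e * k + d) - (- k ^+ 3 + - t * k ^+ 2 - e * k + - d)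
     - 2 * k ^+ 3); first by ring.
by rewrite e1 e2; ring.
Qed.

(* A rational point of the circle, complementing 1 and i as a test value. *)
Definition unit34 (e : R) : C := (3 / 5) +i* (e * (4 / 5)).

Lemma unit34_unit e : e ^+ 2 = 1 -> unit34 e * (unit34 e)^c = 1.
Proof.
move=> e2; apply/eqP; rewrite eq_complex /=; apply/andP; split; apply/eqP; last by ring.
by transitivity (9 / 25 + e ^+ 2 * 16 / 25); [field|rewrite e2; field].
Qed.

Lemma unit_i : ('i%C : C) * ('i%C)^c = 1.
Proof. by apply/eqP; rewrite eq_complex /=; apply/andP; split; apply/eqP; ring. Qed.

Lemma Re_unit_eq0 (f : C) : (forall z : C, z * z^c = 1 -> Re (z * f) = 0) -> f = 0.
Proof.
move=> H; have := H 1; have := H 'i%C unit_i; rewrite conjc1 mulr1 mul1r => + /(_ erefl).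
by case: f {H} => a b /= hb ha; apply/eqP; rewrite eq_complex /= ha eqxx /=; apply/eqP; lra.
Qed.

Lemma cubic_identity (N B : R) (d sg tau : C) :
  (forall z : C, z * z^c = 1 -> N * Re (z * d) = 4 * (B + Re (z * sg) ^+ 2) * Re (z * tau)) ->
  sg * sg * tau = 0.
Proof.
move=> H; have h1 : N * Re (1 * d) = 4 * (B + Re (1 * sg) ^+ 2) * Re (1 * tau) by apply: H; rewrite conjc1 mulr1.
have h2 := H 'i%C unit_i.
have h3 := H _ (unit34_unit 1 (expr1n _ _)).
have h4 := H _ (unit34_unit (-1) (etrans (sqrrN _) (expr1n _ _))).
move: h1 h2 h3 h4; rewrite /unit34; case: d sg tau {H} => d1 d2 [s t] [t1 t2] /= h1 h2 h3 h4.
have combine k (a1 b1 a3 b3 a4 b4 e f : R) : a1 = b1 -> a3 = b3 -> a4 = b4 ->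
    k * (e * (a3 - b3) + (a4 - b4) - f * (a1 - b1)) = 0.
  by move=> -> -> ->; ring.
apply/eqP; rewrite eq_complex /=; apply/andP; split; apply/eqP.
- by rewrite -[RHS](combine (125 / 384) _ _ _ _ _ _ 1 (6 / 5) h1 h3 h4); field.
- by rewrite -[RHS](combine (- (125 / 288)) _ _ _ _ _ _ (-1) (- (8 / 5)) h2 h3 h4); field.
Qed.

Lemma Re_square_const (f K : C) : (forall z : C, z * z^c = 1 -> z * z * f + (z * z * f)^c = K) -> f = 0.
Proof.
move=> H; have h1 : 1 * 1 * f + (1 * 1 * f)^c = K by apply: H; rewrite conjc1 mulr1.
have h2 := H 'i%C unit_i.
have h3 := H _ (unit34_unit 1 (expr1n _ _)).
have h4 := H _ (unit34_unit (-1) (etrans (sqrrN _) (expr1n _ _))).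
move: h1 h2 h3 h4; rewrite /unit34; case: f {H} => a b; case: K => e g /= [h1 _] [h2 _] [h3 _] [h4 _].
by apply/eqP; rewrite eq_complex /=; apply/andP; split; apply/eqP; lra.
Qed.

Section Unitary.
Variables (U A : 'M[C]_3).
Hypothesis UU : adjmx U *m U = 1%:M.

Lemma conj_unitaryE : U *m A = (U *m A *m adjmx U) *m U.
Proof. by rewrite -!mulmxA UU mulmx1. Qed.

Lemma range_unitary z : numerical_range (U *m A *m adjmx U) z <-> numerical_range A z.
Proof.
have UU' : U *m adjmx U = 1%:M by apply: mulmx1C.
split=> /numerical_rangeP[x x1 ->]; apply/numerical_rangeP.
  exists (adjmx U *m x); first by rewrite N2_unitary ?adjmxK.
  by rewrite adjmxM adjmxK !mulmxA.
exists (U *m x); first by rewrite N2_unitary.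
rewrite adjmxM !mulmxA -[adjmx x *m adjmx U *m U]mulmxA UU mulmx1.
by rewrite -[adjmx x *m A *m adjmx U *m U]mulmxA UU mulmx1.
Qed.

Lemma centred_ellipse_unitary sg L :
  centred_ellipse A sg L -> centred_ellipse (U *m A *m adjmx U) sg L.
Proof. by move=> [sL EA]; split=> // w; rewrite range_unitary. Qed.

Lemma crouzeix_conj_unitary : crouzeix_sq (U *m A *m adjmx U) -> crouzeix_sq A.
Proof. by apply: crouzeix_sq_unitary UU conj_unitaryE. Qed.

End Unitary.

Definition lower_block (p q r s : C) := mx3 1 0 0 0 p q 0 r s.
Definition upper_block (p q r s : C) := mx3 p q 0 r s 0 0 0 1.

Definition unitary2 (p q r s : C) :=
  [/\ p * p^c + q * q^c = 1, r * r^c + s * s^c = 1 & p * r^c + q * s^c = 0].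

Lemma block_unitary p q r s : unitary2 p q r s ->
  adjmx (lower_block p q r s) *m lower_block p q r s = 1%:M /\
  adjmx (upper_block p q r s) *m upper_block p q r s = 1%:M.
Proof.
move=> [pq rs ort]; have ort' : r * p^c + s * q^c = 0.
  have -> : r * p^c + s * q^c = (p * r^c + q * s^c)^c by rewrite conjcD !conjcM !conjcK; ring.
  by rewrite ort conjc0.
split; apply: mulmx1C; rewrite mx3_adj mx3_mul mx3_scalar ?conjc0 ?conjc1;
  by congr mx3; rewrite ?mulr0 ?mul0r ?mulr1 ?add0r ?addr0.
Qed.

Lemma givens (x y : C) : exists p q r s, unitary2 p q r s /\ x * r^c + y * s^c = 0.
Proof.
pose n := Num.sqrt (nsq x + nsq y).
have n_ge0 : 0 <= nsq x + nsq y by rewrite addr_ge0 ?nsq_ge0.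
have n2 : n ^+ 2 = nsq x + nsq y by rewrite sqr_sqrtr.
move: (n_ge0); rewrite le_eqVlt => /orP[/eqP/esym/eqP|n_gt0].
  rewrite paddr_eq0 ?nsq_ge0 // => /andP[/eqP/nsq_eq0 -> /eqP/nsq_eq0 ->].
  exists 1, 0, 0, 1; rewrite !mul0r addr0; split=> //.
  by rewrite /unitary2 conjc0 conjc1; split; ring.
have n0 : 0 < n by rewrite sqrtr_gt0.
have [pq _ xq] := rotation_to_axis x y n n0 n2.
exists (x / n%:C), (y / n%:C), (- (y / n%:C)^c), (x / n%:C)^c.
rewrite /unitary2 !conjcN !conjcK; split; last by rewrite -xq; ring.
by split=> //; [rewrite -pq|]; ring.
Qed.

Lemma traceless_hollow (a b g : C) : exists p q r s, unitary2 p q r s /\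
  (p * a + q * g) * p^c + (p * b - q * a) * q^c = 0 /\
  (r * a + s * g) * r^c + (r * b - s * a) * s^c = 0.
Proof.
have [->|a0] := eqVneq a 0.
  exists 1, 0, 0, 1; rewrite /unitary2 conjc0 conjc1; split; [split; ring|split; ring].
have [e [ee eE]] := unit_phase (g / a - (b / a)^c).
pose w := b / a * e^c + g / a * e.
have w_real : w = (Re w)%:C.
  have : w - w^c = 0.
    rewrite /w conjcD !(conjcM _ (e^c)) (conjcM (g / a)) conjcK.
    have -> : b / a * e^c + g / a * e - ((b / a)^c * e + (g / a)^c * e^c)
      = e * (g / a - (b / a)^c) - (e * (g / a - (b / a)^c))^c.
      by rewrite (conjcM e) conjcD conjcN conjcK; ring.
    by rewrite eE conjc_real subrr.
  case: (w) => x y /= [_]; rewrite opprK -mulr2n => /eqP; rewrite mulrn_eq0 /= => /eqP ->.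
  by [].
set k := Re w in w_real.
pose x := (- k + Num.sqrt (k ^+ 2 + 4)) / 2.
have xE : x ^+ 2 + k * x - 1 = 0.
  have rt : Num.sqrt (k ^+ 2 + 4) ^+ 2 = k ^+ 2 + 4 by rewrite sqr_sqrtr // addr_ge0 ?sqr_ge0.
  transitivity ((Num.sqrt (k ^+ 2 + 4) ^+ 2 - k ^+ 2 - 4) / 4); first by rewrite /x; field.
  by rewrite rt; field.
pose n := Num.sqrt (x ^+ 2 + 1); have n0 : 0 < x ^+ 2 + 1 by rewrite ltr_wpDl ?sqr_ge0.
have n2 : n ^+ 2 = x ^+ 2 + 1 by rewrite sqr_sqrtr // ltW.
have nn0 : n != 0 by rewrite gt_eqF // sqrtr_gt0.
have nC : n%:C != 0 :> C by rewrite eq_complex /= negb_and nn0.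
have n2C : n%:C ^+ 2 = x%:C ^+ 2 + e * e^c by rewrite ee -!rmorphXn n2 rmorphD rmorph1.
have xEC : x%:C ^+ 2 + w * x%:C - e * e^c = 0.
  by rewrite w_real ee -rmorphXn -rmorphM -rmorphD -(rmorph1 (real_complex R)) -rmorphB xE.
have zero : x%:C * a * x%:C + e * g * x%:C + (x%:C * b * e^c - e * a * e^c) = 0.
  transitivity (a * (x%:C ^+ 2 + w * x%:C - e * e^c)); last by rewrite xEC mulr0.
  by rewrite /w; field.
exists (x%:C / n%:C), (e / n%:C), (- (e^c / n%:C)), (x%:C / n%:C).
rewrite /unitary2 !(conjcN, conjcM, conjc_inv) conjcK !conjc_real.
split; [split|split].
- by transitivity ((x%:C ^+ 2 + e * e^c) / n%:C ^+ 2); [field|rewrite -n2C divff ?expf_neq0].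
- by transitivity ((x%:C ^+ 2 + e * e^c) / n%:C ^+ 2); [field|rewrite -n2C divff ?expf_neq0].
- by field.
- transitivity ((x%:C * a * x%:C + e * g * x%:C + (x%:C * b * e^c - e * a * e^c)) / n%:C ^+ 2); first by field.
  by rewrite zero mul0r.
- transitivity (- (x%:C * a * x%:C + e * g * x%:C + (x%:C * b * e^c - e * a * e^c)) / n%:C ^+ 2); first by field.
  by rewrite zero oppr0 mul0r.
Qed.

Lemma det3_mx3 (a00 a01 a02 a10 a11 a12 a20 a21 a22 : C) :
  det3 (mx3 a00 a01 a02 a10 a11 a12 a20 a21 a22) =
  a00 * (a11 * a22 - a12 * a21) - a01 * (a10 * a22 - a12 * a20) + a02 * (a10 * a21 - a11 * a20).
Proof. by rewrite /det3 !mxE. Qed.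

Lemma minors3_mx3 (a00 a01 a02 a10 a11 a12 a20 a21 a22 : C) :
  minors3 (mx3 a00 a01 a02 a10 a11 a12 a20 a21 a22) =
  (a00 * a11 - a01 * a10) + (a00 * a22 - a02 * a20) + (a11 * a22 - a12 * a21).
Proof. by rewrite /minors3 /minor2 !mxE. Qed.

Lemma trace3_mx3 (a00 a01 a02 a10 a11 a12 a20 a21 a22 : C) :
  trace3 (mx3 a00 a01 a02 a10 a11 a12 a20 a21 a22) = a00 + a11 + a22.
Proof. by rewrite /trace3 !mxE. Qed.

Lemma rotated_mx3 (p a b q g d z : C) :
  rotated (mx3 0 0 0 p a b q g d) z =
  mx3 0 (z^c * p^c) (z^c * q^c) (z * p) (z * a + z^c * a^c) (z * b + z^c * g^c)
      (z * q) (z * g + z^c * b^c) (z * d + z^c * d^c).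
Proof.
apply/matrixP => i j; rewrite rotatedE.
have c0 : (0 : C)^c = 0 := conjc0 _.
by elim/forall3: i; elim/forall3: j; rewrite !mxE ?[nth _ _ _]/= ?[nth _ _ _]/= ?c0 ?mulr0 ?addr0 ?add0r.
Qed.

Lemma lower_conj (p q r s p0 q0 a b g d : C) :
  lower_block p q r s *m mx3 0 0 0 p0 a b q0 g d *m adjmx (lower_block p q r s) =
  mx3 0 0 0
    (p * p0 + q * q0) ((p * a + q * g) * p^c + (p * b + q * d) * q^c)
    ((p * a + q * g) * r^c + (p * b + q * d) * s^c)
    (r * p0 + s * q0) ((r * a + s * g) * p^c + (r * b + s * d) * q^c)
    ((r * a + s * g) * r^c + (r * b + s * d) * s^c).
Proof. by rewrite mx3_adj !mx3_mul ?conjc0 ?conjc1; congr mx3; ring. Qed.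

Lemma unitary_to_first_axis (v : 'rV[C]_3) : exists U : 'M[C]_3, adjmx U *m U = 1%:M /\
  (v *m adjmx U) 0 o1 = 0 /\ (v *m adjmx U) 0 o2 = 0.
Proof.
have [p [q [r [s [pqrs vrs]]]]] := givens (v 0 o1) (v 0 o2).
have [LL _] := block_unitary _ _ _ _ pqrs; set X := lower_block p q r s in LL.
pose u := v *m adjmx X.
have [p' [q' [r' [s' [pqrs' urs]]]]] := givens (u 0 o0) (u 0 o1).
have [_ UU] := block_unitary _ _ _ _ pqrs'; set Y := upper_block p' q' r' s' in UU.
exists (Y *m X); rewrite adjmxM; split.
  by rewrite -mulmxA [adjmx Y *m _]mulmxA UU mul1mx.
rewrite mulmxA -/u.
have u2 : u 0 o2 = 0.
  by rewrite /u /X /lower_block mx3_adj conjc0 conjc1 mxE sum3 !mxE /= mulr0 add0r.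
clearbody u; split; rewrite /Y /upper_block mx3_adj conjc0 conjc1 mxE sum3 ![mx3 _ _ _ _ _ _ _ _ _ _ _]mxE /=.
  by rewrite mulr0 addr0 urs.
by rewrite !mulr0 u2 mul0r !addr0.
Qed.

Lemma left_kernel_form (A : 'M[C]_3) (v : 'rV[C]_3) : v != 0 -> v *m A = 0 ->
  exists U : 'M[C]_3, adjmx U *m U = 1%:M /\ forall j, (U *m A *m adjmx U) o0 j = 0.
Proof.
move=> v0 vA; have [U [UU [v1 v2]]] := unitary_to_first_axis v; exists U; split=> // j.
set n := v *m adjmx U in v1 v2.
have n0 : n 0 o0 != 0.
  apply: contra v0 => /eqP v00; apply/eqP.
  have -> : v = n *m U by rewrite /n -mulmxA UU mulmx1.
  suff -> : n = 0 by rewrite mul0mx.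
  by apply/matrixP => i k; rewrite ord1 [RHS]mxE; elim/forall3: k.
apply: (mulfI n0); rewrite mulr0.
transitivity ((n *m (U *m A *m adjmx U)) 0 j).
  by rewrite [RHS]mxE sum3 v1 v2 !mul0r !addr0.
by rewrite !mulmxA /n -[v *m adjmx U *m U]mulmxA UU mulmx1 vA mul0mx mxE.
Qed.

Lemma disc_form_crouzeix (a t c d : C) (L : R) : 0 < L ->
  centred_ellipse (mx3 0 0 0 a t 0 c d 0) 0 L -> crouzeix_sq (mx3 0 0 0 a t 0 c d 0).
Proof.
move=> L0 EA; set A := mx3 _ _ _ _ _ _ _ _ _ in EA *.
have H0 z : L ^+ 2 / 4 - nsq 0 + Re (z * 0) ^+ 2 = L ^+ 2 / 4.
  by rewrite mulr0 nsq0 subr0 /= expr0n addr0.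
have L4 : 4 * (L ^+ 2 / 4) = L ^+ 2 by field.
have kip z (zz : z * z^c = 1) := kippenhahn A 0 L z EA zz.
have sum2C (x y : C) : (nsq x + nsq y)%:C = x * x^c + y * y^c by rewrite -!nsqC -rmorphD.
have sum3C : (nsq a + nsq c + nsq d)%:C = a * a^c + c * c^c + d * d^c by rewrite -!nsqC -!rmorphD.
have cl0 : (0 : C)^c = 0 := conjc0 _.
have acd : nsq a + nsq c + nsq d = L ^+ 2.
  have [_] := kip 1 (etrans (mul1r _) (conjc1 _)); rewrite H0 L4 => /(_ _).
  rewrite divr_gt0 ?exprn_gt0 // => /(_ isT) mA; apply: (@complexI R).
  rewrite sum3C -[RHS]opprK -mA rotated_mx3 minors3_mx3 !cl0 conjc1; ring.
have adc : t * (nsq a + nsq d)%:C = - (a * d * c^c).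
  apply/eqP; rewrite -subr_eq0; apply/eqP; apply: Re_unit_eq0 => z zz.
  have [+ _] := kip z zz; rewrite H0 L4 -acd => dA.
  have : z * (t * (nsq a + nsq d)%:C - - (a * d * c^c)) + (z * (t * (nsq a + nsq d)%:C - - (a * d * c^c)))^c = 0.
    rewrite conjcM conjcD opprK !(conjcM _ c^c) (conjcM t) conjcK conjc_real (conjcM a d).
    rewrite sum2C.
    transitivity (det3 (rotated A z) + (nsq a + nsq c + nsq d)%:C * trace3 (rotated A z)); last by rewrite dA addNr.
    rewrite sum3C /A rotated_mx3 det3_mx3 trace3_mx3 !cl0.
    pose zz' := z * z^c; transitivity (z * (t * (a * a^c + d * d^c)) + z^c * (t^c * (a * a^c + d * d^c)) +
      (zz' * z * (a * d * c^c) + zz' * z^c * (a^c * d^c * c)) + (1 - zz') * (z * t + z^c * t^c) * (c * c^c)).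
      by rewrite /zz' zz; ring.
    by rewrite /zz'; ring.
  case: (z * _) => x y /= [/eqP]; rewrite -mulr2n mulrn_eq0 /= => /eqP -> //.
pose k := 2 / L; have k0 : k * (L / 2) = 1 by rewrite /k; field; rewrite gt_eqF.
have AE : A = 0%:M + (L / 2)%:C *: disc_model (k%:C * a) (k%:C * c) (k%:C * d) (k%:C * t).
  have kC (x : C) : (L / 2)%:C * (k%:C * x) = x by rewrite mulrA -rmorphM mulrC mulrC [L / 2 * _]mulrC k0 mul1r.
  apply/matrixP => i j; elim/forall3: i; elim/forall3: j;
  by rewrite !mxE /= mul0rn add0r ?mulr0 ?kC.
rewrite AE; apply: crouzeix_sq_affine; apply: disc_crouzeix.
- rewrite !nsqM !nsq_real; transitivity (k ^+ 2 * (nsq a + nsq c + nsq d)); first by ring.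
  by rewrite acd /k; field; rewrite gt_eqF.
- rewrite !nsqM !nsq_real conjcM conjc_real.
  transitivity (k%:C ^+ 3 * (t * (nsq a + nsq d)%:C)); last by rewrite adc; ring.
  have -> : k ^+ 2 * nsq a + k ^+ 2 * nsq d = k * k * (nsq a + nsq d) by ring.
  by rewrite (rmorphM _ (k * k)) (rmorphM _ k) /=; ring.
- move=> w ww; have Aw : numerical_range A ((L / 2)%:C * w).
    apply/EA.2; rewrite subr0 addr0 /cmod Normc.normcM -!/(cmod _).
    have -> : cmod w = 1 by apply/eqP; rewrite -(@pexpr_eq1 _ _ 2) ?cmod_ge0 // cmod_sqr; apply/eqP/(@complexI R); rewrite nsqC ww.
    have -> : cmod (L / 2)%:C = L / 2.
      by apply/eqP; rewrite -(@eqrXn2 _ 2) ?cmod_ge0 ?divr_ge0 ?ltW // cmod_sqr nsq_real.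
    by rewrite le_eqVlt; apply/orP; left; apply/eqP; field.
  move: Aw => /numerical_rangeP[x x1 xE]; apply/numerical_rangeP; exists x => //.
  have L0C : (L / 2)%:C != 0 :> C by rewrite eq_complex /= gt_eqF ?divr_gt0.
  apply: (mulfI L0C); rewrite xE AE mulmxDr mulmxDl -scalemxAr -scalemxAl.
  have -> : (0%:M : 'M[C]_3) = 0 by apply: raddf0.
  by rewrite mulmx0 mul0mx add0r [LHS]mxE.
Qed.

Lemma centred_disc_crouzeix (p a b g d : C) (L : R) : 0 < L ->
  centred_ellipse (mx3 0 0 0 p a b 0 g d) 0 L -> crouzeix_sq (mx3 0 0 0 p a b 0 g d).
Proof.
move=> L0 EA; set A := mx3 _ _ _ _ _ _ _ _ _ in EA *.
have adbg : a * d = b * g.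
  apply/eqP; rewrite -subr_eq0; apply/eqP.
  apply: (Re_square_const _ (p * p^c + b * b^c + g * g^c - a * d^c - a^c * d - (L ^+ 2)%:C)) => z zz.
  have [_] := kippenhahn A 0 L z EA zz.
  rewrite mulr0 nsq0 subr0 /= expr0n addr0 (_ : 4 * (L ^+ 2 / 4) = L ^+ 2); last by field.
  rewrite divr_gt0 ?exprn_gt0 // => /(_ isT).
  rewrite /A rotated_mx3 minors3_mx3 conjc0 !conjcM conjcD conjcN !conjcM => mA.
  rewrite -mA; pose zz' := z * z^c.
  transitivity (z * z * (a * d - b * g) + z^c * z^c * (a^c * d^c - b^c * g^c)); first by ring.
  transitivity (z * z * (a * d - b * g) + z^c * z^c * (a^c * d^c - b^c * g^c)
    + (1 - z * z^c) * (p * p^c + b * b^c + g * g^c - a * d^c - a^c * d)); first by rewrite zz; ring.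
  by ring.
have reduce x y : (forall r s : C, x * r^c + y * s^c = 0 -> a * r^c + b * s^c = 0 /\ g * r^c + d * s^c = 0) ->
    crouzeix_sq A.
  have [q [r [s [t [qrst xy]]]]] := givens x y => /(_ _ _ xy) [ab gd].
  have [UU _] := block_unitary _ _ _ _ qrst.
  apply: (crouzeix_conj_unitary _ _ UU); have := centred_ellipse_unitary _ _ UU _ _ EA.
  rewrite lower_conj.
  have -> : (q * a + r * g) * s^c + (q * b + r * d) * t^c = 0.
    by transitivity (q * (a * s^c + b * t^c) + r * (g * s^c + d * t^c)); [ring|rewrite ab gd !mulr0 addr0].
  have -> : (s * a + t * g) * s^c + (s * b + t * d) * t^c = 0.
    by transitivity (s * (a * s^c + b * t^c) + t * (g * s^c + d * t^c)); [ring|rewrite ab gd !mulr0 addr0].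
  exact: disc_form_crouzeix.
have [a0|a0] := eqVneq a 0; last first.
  apply: (reduce a b) => r s ab; split=> //; apply: (mulfI a0); rewrite mulr0.
  transitivity (g * (a * r^c + b * s^c) + (a * d - b * g) * s^c); first by ring.
  by rewrite ab adbg subrr mulr0 mul0r addr0.
have [b0|b0] := eqVneq b 0; last first.
  apply: (reduce a b) => r s ab; split=> //; apply: (mulfI b0); rewrite mulr0.
  transitivity (d * (a * r^c + b * s^c) - (a * d - b * g) * r^c); first by ring.
  by rewrite ab adbg subrr mulr0 mul0r subr0.
by apply: (reduce g d) => r s gd; rewrite a0 b0 !mul0r addr0.
Qed.

Lemma centred_ellipse_crouzeix (p a b g d : C) sg L :
  centred_ellipse (mx3 0 0 0 p a b 0 g d) sg L -> crouzeix_sq (mx3 0 0 0 p a b 0 g d).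
Proof.
move=> EA; set A := mx3 _ _ _ _ _ _ _ _ _ in EA *.
have H0 := centred_ellipse_bound A sg L EA.
have pd z : z * z^c = 1 ->
    nsq p * Re (z * d) = 4 * ((L ^+ 2 / 4 - nsq sg) + Re (z * sg) ^+ 2) * Re (z * (a + d)).
  move=> zz; have [+ _] := kippenhahn A sg L z EA zz.
  rewrite /A rotated_mx3 det3_mx3 trace3_mx3 conjc0.
  set H := _ + Re (z * sg) ^+ 2; move: H => H dA.
  have : (nsq p)%:C * (z * d + (z * d)^c) = (4 * H)%:C * (z * (a + d) + (z * (a + d))^c).
    rewrite nsqC !conjcM conjcD.
    transitivity (- (0 * ((z * a + z^c * a^c) * (z * d + z^c * d^c) - (z * b + z^c * g^c) * (z * g + z^c * b^c)) - z^c * p^c * (z * p * (z * d + z^c * d^c) - (z * b + z^c * g^c) * (z * 0)) + z^c * 0 * (z * p * (z * g + z^c * b^c) - (z * a + z^c * a^c) * (z * 0)))).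
      transitivity (z * z^c * (p * p^c * (z * d + z^c * d^c))); first by rewrite zz mul1r.
      by ring.
    by rewrite dA; ring.
  case: (z * d) (z * (a + d)) => x y [u v] /= [+ _].
  by rewrite !mul0r !subr0; lra.
have sgad := cubic_identity _ _ _ _ _ pd.
have tri x y z t : tridiag3 0 x y z t = mx3 0 x 0 z 0 y 0 t 0 :> 'M[C]_3.
  by apply/matrixP => i j; rewrite !mxE.
have [ad0|ad0] := eqVneq (a + d) 0.
  have aE : d = - a by apply/eqP; rewrite -addr_eq0 addrC ad0.
  have [p0|p0] := eqVneq p 0.
    have [q [r [s [t [qrst [e1 e2]]]]]] := traceless_hollow a b g.
    have [UU _] := block_unitary _ _ _ _ qrst.
    apply: (crouzeix_conj_unitary _ _ UU); rewrite /A lower_conj p0 aE !mulr0 addr0 !mulrN e1 e2 -tri.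
    exact: tridiag_crouzeix.
  have d0 : d = 0.
    apply: Re_unit_eq0 => z /pd; rewrite ad0 mulr0 /= mulr0 => /eqP.
    by rewrite mulf_eq0 => /orP[/eqP/nsq_eq0 pz|/eqP //]; rewrite pz eqxx in p0.
  have a0 : a = 0 by rewrite -[a]opprK -aE d0 oppr0.
  by rewrite /A d0 a0 -tri; apply: tridiag_crouzeix.
have sg0 : sg = 0.
  by move/eqP: sgad; rewrite !mulf_eq0 (negPf ad0) orbF orbb => /eqP.
rewrite sg0 in EA.
have L_ge0 : 0 <= L by have [+ _] := EA; rewrite /cmod Normc.normc0 mulr0.
move: L_ge0; rewrite le_eqVlt => /orP[/eqP L0|L0]; last exact: centred_disc_crouzeix L0 EA.
have range0 w : numerical_range A w -> w = 0.
  move/EA.2; rewrite -L0 subr0 addr0 => cw; apply: Normc.eq0_normc; apply/eqP.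
  by rewrite eq_le cmod_ge0 andbT; move: cw; rewrite /cmod; lra.
have a0 : a = 0.
  apply: range0; have := @numerical_range3 R A (cv3 0 1 0).
  rewrite N2_3 !cv3E nsq0 add0r addr0 (nsq_real 1) expr1n => /(_ erefl).
  by rewrite mx3_mulv !cv3E conjc0 conjc1 !mul0r !mulr0 mul1r mulr1 ?add0r !addr0 ?add0r.
have d0 : d = 0.
  apply: range0; have := @numerical_range3 R A (cv3 0 0 1).
  rewrite N2_3 !cv3E nsq0 !add0r (nsq_real 1) expr1n => /(_ erefl).
  by rewrite mx3_mulv !cv3E conjc0 conjc1 !mul0r !mulr0 mul1r mulr1 !add0r.
by rewrite a0 d0 addr0 eqxx in ad0.
Qed.

Lemma centred_ellipse_shift (M : 'M[C]_3) c : is_ellipse_centered (numerical_range M) c ->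
  exists sg L, centred_ellipse (M - c%:M) sg L.
Proof.
move=> [f1 [f2 [L [fL ME cE]]]]; exists ((f1 - f2) / 2), L; split.
  apply: le_trans fL; rewrite le_eqVlt; apply/orP; left; apply/eqP.
  have -> : f1 - f2 = 2%:C * ((f1 - f2) / 2) by rewrite rmorph_nat; field.
  rewrite {2}/cmod Normc.normcM -!/(cmod _) (_ : cmod 2%:C = 2).
    by congr (_ * cmod _); rewrite rmorph_nat; field.
  by apply/eqP; rewrite -(@eqrXn2 _ 2) ?cmod_ge0 // cmod_sqr nsq_real.
move=> w; transitivity (numerical_range M (w + c)); last first.
  rewrite ME /ellipse /= cE; have -> : w + (f1 + f2) / 2 - f1 = w - (f1 - f2) / 2 by field.
  by have -> : w + (f1 + f2) / 2 - f2 = w + (f1 - f2) / 2 by field.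
have shift (x : 'cV[C]_3) : N2 x = 1 ->
    (adjmx x *m (M - c%:M) *m x) 0 0 = (adjmx x *m M *m x) 0 0 - c.
  move=> x1; rewrite mulmxBr mulmxBl mul_mx_scalar -scalemxAl [LHS]mxE; congr (_ + _).
  by rewrite [LHS]mxE [X in - X]mxE N2_adj x1 mulr1.
split=> /numerical_rangeP[x x1 E]; apply/numerical_rangeP; exists x => //.
  by rewrite E shift // subrK.
by rewrite shift // -E addrK.
Qed.

Lemma ellipse_eigenvalue_crouzeix (M : 'M[C]_3) c :
  is_ellipse_centered (numerical_range M) c -> eigenvalue M c -> crouzeix_sq M.
Proof.
move=> /centred_ellipse_shift[sg [L EA]] /eigenvalueP[v vM v0].
set A := M - c%:M in EA.
have -> : M = c%:M + 1 *: A by rewrite scale1r addrC subrK.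
apply: crouzeix_sq_affine.
have vA : v *m A = 0 by rewrite mulmxBr mul_mx_scalar vM subrr.
have [U [UU row0]] := left_kernel_form A v v0 vA.
apply: (crouzeix_conj_unitary _ _ UU).
have := centred_ellipse_unitary _ _ UU _ _ EA.
move: (U *m A *m adjmx U) row0 => B row0.
rewrite (mx3_eta B) !row0.
move: (B o1 o0) (B o1 o1) (B o1 o2) (B o2 o0) (B o2 o1) (B o2 o2) => p0 a b q0 g d EB.
have [p [q [r [s [pqrs pq]]]]] := givens p0^c q0^c.
have [XX _] := block_unitary _ _ _ _ pqrs.
apply: (crouzeix_conj_unitary _ _ XX).
have := centred_ellipse_unitary _ _ XX _ _ EB.
have rs : r * p0 + s * q0 = 0.
  by rewrite -[LHS]conjcK conjcD !conjcM -[RHS]conjc0 -pq; congr (_^c); ring.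
by rewrite lower_conj rs; apply: centred_ellipse_crouzeix.
Qed.

End Kippenhahn.

Theorem theorem1p2 (R : realType) :
  (forall (a b1 b2 c1 c2 : R[i]) (p : {poly R[i]}),
     crouzeix_ineq (tridiag3 a b1 b2 c1 c2) p)
  /\
  (forall (M : 'M[R[i]]_3) (p : {poly R[i]}) (c : R[i]),
     is_ellipse_centered (numerical_range M) c ->
     eigenvalue M c ->
     crouzeix_ineq M p).
Proof.
split=> [a b1 b2 c1 c2 p|M p c Mc eigc]; apply: crouzeix_sq_ineq.
  exact: tridiag_crouzeix.
exact: ellipse_eigenvalue_crouzeix Mc eigc.
Qed.
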